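(* Let $R$ be an almost perfect domain with field of quotients $Q\neq R$. Then $$\mathcal{I}=\mathcal{I}_1,\qquad \mathcal{F}=\mathcal{F}_1=\mathcal{P}_1=\mathcal{P}.$$
   Context: All rings are commutative with $1\neq 0$ and all modules are unital. A ring is perfect if every module over it has a projective cover. An almost perfect domain is an integral domain $R$ such that $R/I$ is perfect for every non-zero proper ideal $I$. For $n\ge 0$, $\mathcal{P}_n$, $\mathcal{I}_n$, $\mathcal{F}_n$ denote the classes of $R$-modules of projective, injective, and weak (flat) dimension at most $n$, respectively, and $\mathcal{P}=\bigcup_{n\ge0}\mathcal{P}_n$, $\mathcal{I}=\bigcup_{n\ge0}\mathcal{I}_n$, $\mathcal{F}=\bigcup_{n\ge0}\mathcal{F}_n$. *)

(* Defs.v *)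
From HB Require Import structures.
From mathcomp Require Import all_boot all_algebra.
From mathcomp Require Import ring_quotient generic_quotient fraction.
From mathcomp Require Import boolp.

Set Implicit Arguments.
Unset Strict Implicit.
Unset Printing Implicit Defensive.

Import GRing.Theory.
Local Open Scope ring_scope.
Local Open Scope quotient_scope.

(* M (x) N is the set of finite formal sums of pairs (m, n) modulo the
   congruence generated by commutativity and the bilinearity relations.  The
   formal sums only form a monoid, so [(0, n)] = 0 has to be imposed as well;
   inverses are then given by (- m, n). *)
Section Tensor.
Variables (R : comNzRingType) (M N : lmodType R).

Inductive tensor_rel : seq (M * N) -> seq (M * N) -> Prop :=
| TensorRefl s : tensor_rel s s
| TensorSym s t : tensor_rel s t -> tensor_rel t s
| TensorTrans s t u : tensor_rel s t -> tensor_rel t u -> tensor_rel s u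
| TensorCat s s' t t' :
    tensor_rel s s' -> tensor_rel t t' -> tensor_rel (s ++ t) (s' ++ t')
| TensorComm s t : tensor_rel (s ++ t) (t ++ s)
| Tensor0l n : tensor_rel [:: (0, n)] [::]
| TensorDl m m' n : tensor_rel [:: (m + m', n)] [:: (m, n); (m', n)]
| TensorDr m n n' : tensor_rel [:: (m, n + n')] [:: (m, n); (m, n')]
| TensorZ a m n : tensor_rel [:: (a *: m, n)] [:: (m, a *: n)].

Definition tensor_eqb (s t : seq (M * N)) : bool := `[< tensor_rel s t >].

Lemma tensor_eqb_refl : reflexive tensor_eqb.
Proof. by move=> s; apply/asboolP/TensorRefl. Qed.

Lemma tensor_eqb_sym : symmetric tensor_eqb.
Proof. by move=> s t; apply/asboolP/asboolP => /TensorSym. Qed.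

Lemma tensor_eqb_trans : transitive tensor_eqb.
Proof.
by move=> t s u /asboolP st /asboolP tu; apply/asboolP/(TensorTrans st tu).
Qed.

Canonical tensor_equiv :=
  EquivRel tensor_eqb tensor_eqb_refl tensor_eqb_sym tensor_eqb_trans.

Definition tensor : Type := {eq_quot tensor_equiv}.
HB.instance Definition _ := Choice.on tensor.
HB.instance Definition _ := EqQuotient.on tensor.

Definition tensor_class (s : seq (M * N)) : tensor := \pi_tensor s.

Definition pure_tensor (m : M) (n : N) : tensor := tensor_class [:: (m, n)].

Lemma tensor_classP s t : tensor_class s = tensor_class t <-> tensor_rel s t.
Proof.
split=> [/eqquotP/asboolP //|st].
by apply/eqquotP/asboolP.
Qed.

Lemma tensor_reprK u : tensor_class (repr u) = u.
Proof. exact: reprK. Qed.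

Lemma tensor_repr s : tensor_rel (repr (tensor_class s)) s.
Proof. by apply/tensor_classP; rewrite tensor_reprK. Qed.

Definition tensor_add (u v : tensor) := tensor_class (repr u ++ repr v).

Definition tensor_scale (a : R) (u : tensor) :=
  tensor_class [seq (a *: x.1, x.2) | x <- repr u].

Definition tensor_opp (u : tensor) := tensor_scale (- 1) u.

Lemma tensor_addE s t :
  tensor_add (tensor_class s) (tensor_class t) = tensor_class (s ++ t).
Proof. by apply/tensor_classP; apply: TensorCat; apply: tensor_repr. Qed.

Lemma tensor_scaleE a s :
  tensor_scale a (tensor_class s)
    = tensor_class [seq (a *: x.1, x.2) | x <- s].
Proof.
apply/tensor_classP.
move: (repr _) (tensor_repr s) => s0; elim=> {s0 s} //=.
- by move=> s; apply: TensorRefl.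
- by move=> s t _; apply: TensorSym.
- by move=> s t u _ st _; apply: TensorTrans.
- by move=> s s' t t' _ ss' _ tt'; rewrite !map_cat; apply: TensorCat.
- by move=> s t; rewrite !map_cat; apply: TensorComm.
- by move=> n; rewrite scaler0; apply: Tensor0l.
- by move=> m m' n; rewrite scalerDr; apply: TensorDl.
- by move=> m n n'; apply: TensorDr.
- move=> b m n; rewrite scalerA mulrC -scalerA; exact: TensorZ.
Qed.

Lemma tensor_addA : associative tensor_add.
Proof.
move=> u v w; rewrite -(tensor_reprK u) -(tensor_reprK v) -(tensor_reprK w).
by rewrite !tensor_addE catA.
Qed.

Lemma tensor_addC : commutative tensor_add.
Proof. by move=> u v; apply/tensor_classP/TensorComm. Qed.

Lemma tensor_add0 : left_id (tensor_class [::]) tensor_add.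
Proof. by move=> u; rewrite -{1}(tensor_reprK u) tensor_addE tensor_reprK. Qed.

Lemma tensor_scaleDl a b u :
  tensor_scale (a + b) u = tensor_add (tensor_scale a u) (tensor_scale b u).
Proof.
rewrite tensor_addE; apply/tensor_classP.
elim: (repr u) => [|[m n] s IHs] /=; first exact: TensorRefl.
rewrite scalerDl -cat1s.
apply: TensorTrans (TensorCat (TensorDl _ _ _) IHs) _ => /=.
rewrite -[in X in tensor_rel X]cat1s.
apply: (TensorCat (TensorRefl [:: (a *: m, n)])); rewrite -cat1s !catA.
rewrite -[X in tensor_rel _ (_ ++ X)]cat1s catA.
exact: TensorCat (TensorComm _ _) (TensorRefl _).
Qed.

Lemma tensor_scale0 u : tensor_scale 0 u = tensor_class [::].
Proof.
apply/tensor_classP; elim: (repr u) => [|[m n] s IHs] /=.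
  exact: TensorRefl.
by rewrite scale0r -cat1s; apply: TensorCat (Tensor0l n) IHs.
Qed.

Lemma tensor_scale1 : left_id 1 tensor_scale.
Proof.
move=> u; rewrite -[RHS]tensor_reprK; congr tensor_class.
by rewrite -[RHS]map_id; apply: eq_map => -[m n] /=; rewrite scale1r.
Qed.

Lemma tensor_addN : left_inverse (tensor_class [::]) tensor_opp tensor_add.
Proof.
move=> u; rewrite -{2}(tensor_scale1 u) -tensor_scaleDl addNr.
exact: tensor_scale0.
Qed.

Lemma tensor_scaleA a b u :
  tensor_scale a (tensor_scale b u) = tensor_scale (a * b) u.
Proof.
rewrite tensor_scaleE -map_comp; congr tensor_class.
by apply: eq_map => -[m n] /=; rewrite scalerA.
Qed.

Lemma tensor_scaleDr : right_distributive tensor_scale tensor_add.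
Proof.
move=> a u v; rewrite -(tensor_reprK u) -(tensor_reprK v).
by rewrite !(tensor_scaleE, tensor_addE) map_cat.
Qed.

HB.instance Definition _ :=
  GRing.isZmodule.Build tensor tensor_addA tensor_addC tensor_add0 tensor_addN.

HB.instance Definition _ := GRing.Zmodule_isLmodule.Build R tensor
  tensor_scaleA tensor_scale1 tensor_scaleDr
  (fun u a b => tensor_scaleDl a b u).

Lemma tensor_class_cat s t :
  tensor_class (s ++ t) = tensor_class s + tensor_class t.
Proof. by rewrite -tensor_addE. Qed.

Lemma tensor_class_sum s :
  tensor_class s = \sum_(x <- s) pure_tensor x.1 x.2.
Proof.
elim: s => [|[m n] s IHs]; first by rewrite big_nil.
by rewrite big_cons -IHs -tensor_class_cat.
Qed.

Lemma pure_tensor_linearl n : linear (pure_tensor^~ n).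
Proof.
move=> a m m'; rewrite -[a *: pure_tensor m n]/(tensor_scale a _).
rewrite tensor_scaleE -tensor_class_cat; apply/tensor_classP; exact: TensorDl.
Qed.

Lemma pure_tensor_linearr m : linear (pure_tensor m).
Proof.
move=> a n n'; rewrite -[a *: pure_tensor m n]/(tensor_scale a _).
rewrite tensor_scaleE -tensor_class_cat; apply/tensor_classP.
apply: TensorTrans (TensorDr _ _ _) _.
apply: (@TensorCat [:: _] [:: _] [:: _] [:: _]) (TensorRefl _).
exact/TensorSym/TensorZ.
Qed.

Section Lift.
Variables (P : lmodType R) (b : M -> N -> P).

Definition tensor_lift (u : tensor) : P := \sum_(x <- repr u) b x.1 x.2.

Hypotheses (bl : forall n, linear (b^~ n)) (br : forall m, linear (b m)).

Lemma tensor_lift_class s :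
  tensor_lift (tensor_class s) = \sum_(x <- s) b x.1 x.2.
Proof.
pose L n := GRing.isLinear.Build R M P *:%R (b^~ n) (bl n).
pose fl n : {linear M -> P} := HB.pack (b^~ n) (L n).
pose L' m := GRing.isLinear.Build R N P *:%R (b m) (br m).
pose fr m : {linear N -> P} := HB.pack (b m) (L' m).
rewrite /tensor_lift.
move: (repr _) (tensor_repr s) => s0; elim=> {s0 s} //=.
- by move=> s t u _ -> _ ->.
- by move=> s s' t t' _ IH _ IH'; rewrite !big_cat /= IH IH'.
- by move=> s t; rewrite !big_cat /= addrC.
- by move=> n; rewrite big_nil big_seq1; apply: (raddf0 (fl n)).
- move=> m m' n; rewrite !big_cons big_nil !addr0; exact: (raddfD (fl n)).
- move=> m n n'; rewrite !big_cons big_nil !addr0; exact: (raddfD (fr m)).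
- move=> a m n; rewrite !big_cons big_nil !addr0 /=.
  have -> : b (a *: m) n = a *: b m n by apply: (linearZ_LR (fl n)).
  by apply/esym/(linearZ_LR (fr m)).
Qed.

Lemma tensor_lift_pure m n : tensor_lift (pure_tensor m n) = b m n.
Proof. by rewrite tensor_lift_class big_seq1. Qed.

Lemma tensor_lift_linear : linear tensor_lift.
Proof.
move=> a u v; rewrite -(tensor_reprK u) -(tensor_reprK v).
rewrite -[a *: tensor_class _]/(tensor_scale a _) tensor_scaleE.
rewrite -tensor_class_cat !tensor_lift_class big_cat /= big_map scaler_sumr.
congr (_ + _); apply: eq_bigr => -[m n] _ /=.
pose L := GRing.isLinear.Build R M P *:%R (b^~ n) (bl n).
pose fl : {linear M -> P} := HB.pack (b^~ n) L.
exact: (linearZ_LR fl).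
Qed.

Lemma tensor_lift_unique (f : {linear tensor -> P}) :
  (forall m n, f (pure_tensor m n) = b m n) -> f =1 tensor_lift.
Proof.
move=> fb u; rewrite -(tensor_reprK u) tensor_lift_class tensor_class_sum.
by rewrite raddf_sum; apply: eq_bigr => x _; exact: fb.
Qed.

End Lift.
End Tensor.

Definition tensor_map (R : comNzRingType) (M M' N N' : lmodType R)
    (f : {linear M -> M'}) (g : {linear N -> N'}) : tensor M N -> tensor M' N' :=
  tensor_lift (fun m n => pure_tensor (f m) (g n)).

Lemma tensor_map_pure (R : comNzRingType) (M M' N N' : lmodType R)
    (f : {linear M -> M'}) (g : {linear N -> N'}) m n :
  tensor_map f g (pure_tensor m n) = pure_tensor (f m) (g n).
Proof.
apply: tensor_lift_pure => [{}n a x y|{}m a x y] /=; rewrite linearP.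
  exact: pure_tensor_linearl.
exact: pure_tensor_linearr.
Qed.

Lemma tensor_map_linear (R : comNzRingType) (M M' N N' : lmodType R)
    (f : {linear M -> M'}) (g : {linear N -> N'}) : linear (tensor_map f g).
Proof.
apply: tensor_lift_linear => [n a x y|m a x y] /=; rewrite linearP.
  exact: pure_tensor_linearl.
exact: pure_tensor_linearr.
Qed.

Definition surj (A B : Type) (f : A -> B) : Prop := forall y, exists x, f x = y.

Section Modules.
Variable R : comNzRingType.
Implicit Types M : lmodType R.

Definition exact_at (A B C : lmodType R)
    (f : {linear A -> B}) (g : {linear B -> C}) : Prop :=
  forall y : B, g y = 0 <-> exists x : A, f x = y.

Definition projective M : Prop :=
  forall (A B : lmodType R) (g : {linear A -> B}) (f : {linear M -> B}),
    surj g -> exists h : {linear M -> A}, forall x, g (h x) = f x.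

Definition injective_module M : Prop :=
  forall (A B : lmodType R) (i : {linear A -> B}) (f : {linear A -> M}),
    injective i -> exists h : {linear B -> M}, forall x, h (i x) = f x.

Definition flat M : Prop :=
  forall (A B : lmodType R) (i : {linear A -> B}),
    injective i -> injective (tensor_map (idfun : {linear M -> M}) i).

(* M has a left resolution by modules of the class C that vanishes in degrees
   greater than n. *)
Definition left_dim_le (C : lmodType R -> Prop) (n : nat) M : Prop :=
  exists (P : nat -> lmodType R) (d : forall i, {linear P i.+1 -> P i})
         (e : {linear P 0%N -> M}),
    [/\ forall i, C (P i), surj e, exact_at (d 0%N) e,
        forall i, exact_at (d i.+1) (d i)
      & forall i, (n < i)%N -> forall x : P i, x = 0].

Definition right_dim_le (C : lmodType R -> Prop) (n : nat) M : Prop :=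
  exists (E : nat -> lmodType R) (d : forall i, {linear E i -> E i.+1})
         (e : {linear M -> E 0%N}),
    [/\ forall i, C (E i), injective e, exact_at e (d 0%N),
        forall i, exact_at (d i) (d i.+1)
      & forall i, (n < i)%N -> forall x : E i, x = 0].

Definition class_P n : lmodType R -> Prop := left_dim_le projective n.
Definition class_I n : lmodType R -> Prop := right_dim_le injective_module n.
Definition class_F n : lmodType R -> Prop := left_dim_le flat n.

Definition class_Pfin M : Prop := exists n, class_P n M.
Definition class_Ifin M : Prop := exists n, class_I n M.
Definition class_Ffin M : Prop := exists n, class_F n M.

Definition same_class (C D : lmodType R -> Prop) : Prop :=
  forall M, C M <-> D M.

Definition superfluous (P : lmodType R) (K : P -> Prop) : Prop :=
  forall L : {pred P}, GRing.submod_closed L ->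
    (forall x, exists y z, [/\ y \in L, K z & x = y + z]) ->
    forall x, x \in L.

Definition projective_cover M (P : lmodType R) (p : {linear P -> M}) : Prop :=
  [/\ projective P, surj p & superfluous (fun x => p x = 0)].

Definition perfect_ring : Prop :=
  forall M, exists (P : lmodType R) (p : {linear P -> M}), projective_cover p.

End Modules.

(* An [idealr R] is by definition a proper ideal. *)
Definition almost_perfect_domain (R : idomainType) : Prop :=
  forall I : idealr R,
    (exists2 x, x \in I & x != 0) -> perfect_ring {ideal_quot I}.

Definition proper_fraction_field (R : idomainType) : Prop :=
  exists q : {fraction R}, forall r : R, q <> FracField.tofrac r.

(* Main.v *)
From HB Require Import structures.
Require Import Defs.
From mathcomp Require Import all_boot all_algebra.
From mathcomp Require Import ring_quotient generic_quotient fraction.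
From mathcomp Require Import finmap monalg ring.
From mathcomp Require Import boolp classical_sets.

Set Implicit Arguments.
Unset Strict Implicit.
Unset Printing Implicit Defensive.

Import GRing.Theory.
Local Open Scope ring_scope.
Local Open Scope quotient_scope.

(** The theorem reduces to two statements about the first syzygy or cosyzygy,
    both fed by the same consequence of almost perfectness.

    Bass's argument, applied to the projective cover of a direct limit of free
    modules of rank one, shows that a perfect ring satisfies the descending
    chain condition on principal ideals ([perfect_dcc]).  For an almost perfect
    domain [R] this says that each [R/J], [J] nonzero, has simple submodules,
    and that the simple submodule found there also embeds in [R/r] for some
    nonzero [r] ([common_simple]).  So a vanishing statement known for the
    modules [R/r] spreads to all [R/J] by a transfinite induction along simple
    subquotients, performed here with Zorn's lemma.

    Injective dimension.  Let [0 -> C -> E0 -> E1 -> 0] be exact with [E0] and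
    [E1] injective and [C] divisible.  Divisibility gives Ext(R/r, C) = 0, and
    the induction turns this into injectivity of [C] ([kernel_injective]).  The
    cosyzygies of a finite injective resolution are divisible, being images of
    injectives, so descending from the end of the resolution all of them are
    injective, and the dimension is at most one.

    Flat dimension.  Dually, if the kernel of a map [P -> P'] is flat, [P] is
    flat and [P'] is torsion-free, then the image is flat ([image_flat]): the
    torsion-free image has Tor(R/r, -) = 0.  Hence in a finite flat resolution
    all syzygies are flat, and so is the kernel [K] of a free cover of the
    module ([kernel_flat]).

    From flat to projective.  A flat submodule [K] of a free module is then
    projective ([flat_sub_free_projective]).  For [r] nonzero, [K/rK] is flat,
    hence projective, over the perfect ring [R/r]; so a map from [K] to a
    divisible module [D] can be divided by [r] ([flat_hom_divide]).  Iterating,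
    it extends to the localization of [K] at the nonzero elements, and from
    there to the vector space hull of the free module
    ([flat_sub_free_hom_extend]).  A lifting problem for [K] against a quotient
    [G/N] of a free module becomes such an extension problem for [W/N], where
    [W] is the divisible hull of [G].

    Flatness is used through the equational criterion [flat_in]: relations
    lift to relations in a free module.  It follows from flatness in the sense
    of tensor products ([flat_flat_in]), and conversely projective modules are
    flat in that sense ([projective_flat]). *)

(** * Submodules, quotients and free modules *)

Section Linear.
Variables (R : comNzRingType) (U V : lmodType R).

Definition mklin (f : U -> V) (fL : linear f) : {linear U -> V} :=
  HB.pack f (GRing.isLinear.Build R U V *:%R f fL).

Lemma mklinE f fL x : @mklin f fL x = f x. Proof. by []. Qed.
End Linear.

Section Submodules.
Variables (R : comNzRingType) (V : lmodType R).

Record submodule := Submodule {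
  smem :> V -> Prop;
  smem0 : smem 0;
  smemL : forall a x y, smem x -> smem y -> smem (a *: x + y) }.

Implicit Types S : submodule.

Lemma smemD S x y : S x -> S y -> S (x + y).
Proof. by move=> Sx Sy; rewrite -[x]scale1r; apply: smemL. Qed.

Lemma smemZ S a x : S x -> S (a *: x).
Proof. by move=> Sx; rewrite -[_ *: _]addr0; apply: smemL => //; apply: smem0. Qed.

Lemma smemN S x : S x -> S (- x).
Proof. by move=> Sx; rewrite -scaleN1r; apply: smemZ. Qed.

Lemma smemB S x y : S x -> S y -> S (x - y).
Proof. by move=> Sx Sy; apply: smemD => //; apply: smemN. Qed.

Lemma smem_sum S (I : Type) (s : seq I) (F : I -> V) :
  (forall i, S (F i)) -> S (\sum_(i <- s) F i).
Proof. by move=> SF; elim/big_ind: _ => //; [apply: smem0 | apply: smemD]. Qed.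

(** The boolean form of a submodule, on which the subtype construction and the
    quantification in [superfluous] rest. *)
Definition smemb S : {pred V} := fun x => `[< S x >].

Lemma smemb_closed S : GRing.submod_closed (smemb S).
Proof.
split; first exact/asboolP/smem0.
by move=> a x y /asboolP Sx /asboolP Sy; apply/asboolP/smemL.
Qed.

HB.instance Definition _ S :=
  GRing.isSubmodClosed.Build R V (smemb S) (smemb_closed S).

Definition submod S : Type := {x : V | x \in smemb S}.
HB.instance Definition _ S := SubChoice.on (submod S).
HB.instance Definition _ S := [SubChoice_isSubLmodule of submod S by <:].

Definition subinj S : {linear submod S -> V} := \val.

End Submodules.

Section SubmoduleTheory.
Variables (R : comNzRingType) (V : lmodType R) (S : submodule V).

Lemma subinjP (x : submod S) : S (subinj S x).
Proof. exact/asboolP/(valP x). Qed.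

Lemma subinj_inj : injective (subinj S).
Proof. exact: val_inj. Qed.

Lemma subinj_surj x : S x -> exists y, subinj S y = x.
Proof. by move=> /asboolP Sx; exists (Sub x Sx). Qed.

Lemma corestrict (U : lmodType R) (f : {linear U -> V}) :
  (forall x, S (f x)) -> exists g : {linear U -> submod S},
    forall x, subinj S (g x) = f x.
Proof.
move=> Sf; pose g x : submod S := Sub (f x) (introT (asboolP _) (Sf x)).
have gL : linear g by move=> a x y; apply: val_inj; rewrite /= linearP.
by exists (mklin gL).
Qed.

Definition quot_eqb (x y : V) : bool := `[< S (x - y) >].

Lemma quot_eqb_refl : reflexive quot_eqb.
Proof. by move=> x; apply/asboolP; rewrite subrr; apply: smem0. Qed.

Lemma quot_eqb_sym : symmetric quot_eqb.
Proof. by move=> x y; apply/asboolP/asboolP => /smemN; rewrite opprB. Qed.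

Lemma quot_eqb_trans : transitive quot_eqb.
Proof.
move=> y x z /asboolP xy /asboolP yz; apply/asboolP.
by rewrite -(subrK y x) -addrA; apply: smemD.
Qed.

Canonical quot_equiv :=
  EquivRel quot_eqb quot_eqb_refl quot_eqb_sym quot_eqb_trans.

Definition quotmod : Type := {eq_quot quot_equiv}.
HB.instance Definition _ := Choice.on quotmod.
HB.instance Definition _ := EqQuotient.on quotmod.

Definition quot_class (x : V) : quotmod := \pi_quotmod x.

Lemma quot_classP x y : quot_class x = quot_class y <-> S (x - y).
Proof. by split=> [/eqquotP/asboolP|xy] //; apply/eqquotP/asboolP. Qed.

Lemma quot_classK (u : quotmod) : quot_class (repr u) = u.
Proof. exact: reprK. Qed.

Lemma quot_repr x : S (repr (quot_class x) - x).
Proof. by apply/quot_classP; rewrite quot_classK. Qed.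

Definition quot_add (u v : quotmod) := quot_class (repr u + repr v).
Definition quot_opp (u : quotmod) := quot_class (- repr u).
Definition quot_scale a (u : quotmod) := quot_class (a *: repr u).

Lemma quot_addE x y : quot_add (quot_class x) (quot_class y) = quot_class (x + y).
Proof.
by apply/quot_classP; rewrite opprD addrACA; apply: smemD; apply: quot_repr.
Qed.

Lemma quot_oppE x : quot_opp (quot_class x) = quot_class (- x).
Proof. by apply/quot_classP; rewrite -opprB opprK addrC; apply/smemN/quot_repr. Qed.

Lemma quot_scaleE a x : quot_scale a (quot_class x) = quot_class (a *: x).
Proof. by apply/quot_classP; rewrite -scalerBr; apply/smemZ/quot_repr. Qed.

Lemma quot_addA : associative quot_add.
Proof.
move=> u v w; rewrite -(quot_classK u) -(quot_classK v) -(quot_classK w).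
by rewrite !quot_addE addrA.
Qed.

Lemma quot_addC : commutative quot_add.
Proof. by move=> u v; rewrite /quot_add addrC. Qed.

Lemma quot_add0 : left_id (quot_class 0) quot_add.
Proof. by move=> u; rewrite -(quot_classK u) quot_addE add0r. Qed.

Lemma quot_addN : left_inverse (quot_class 0) quot_opp quot_add.
Proof. by move=> u; rewrite -(quot_classK u) quot_oppE quot_addE addNr. Qed.

HB.instance Definition _ :=
  GRing.isZmodule.Build quotmod quot_addA quot_addC quot_add0 quot_addN.

Lemma quot_scaleA a b u : quot_scale a (quot_scale b u) = quot_scale (a * b) u.
Proof. by rewrite -(quot_classK u) !quot_scaleE scalerA. Qed.

Lemma quot_scale1 : left_id 1 quot_scale.
Proof. by move=> u; rewrite -(quot_classK u) quot_scaleE scale1r. Qed.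

Lemma quot_scaleDr : right_distributive quot_scale +%R.
Proof.
move=> a u v; rewrite -(quot_classK u) -(quot_classK v).
by rewrite -[_ + _]/(quot_add _ _) quot_addE !quot_scaleE scalerDr -quot_addE.
Qed.

Lemma quot_scaleDl u : {morph quot_scale^~ u : a b / a + b}.
Proof.
by move=> a b; rewrite -(quot_classK u) !quot_scaleE scalerDl -quot_addE.
Qed.

HB.instance Definition _ := GRing.Zmodule_isLmodule.Build R quotmod
  quot_scaleA quot_scale1 quot_scaleDr quot_scaleDl.

Lemma quot_class_linear : linear quot_class.
Proof.
move=> a x y; rewrite -quot_addE -[a *: quot_class x]/(quot_scale _ _).
by rewrite quot_scaleE.
Qed.

Definition quotpi : {linear V -> quotmod} := mklin quot_class_linear.

Lemma quotpi_eq x y : quotpi x = quotpi y <-> S (x - y).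
Proof. exact: quot_classP. Qed.

Lemma quotpi_eq0 x : quotpi x = 0 <-> S x.
Proof. by rewrite -(linear0 quotpi) quotpi_eq subr0. Qed.

Lemma quotpi_surj : surj quotpi.
Proof. by move=> u; exists (repr u); apply: quot_classK. Qed.

End SubmoduleTheory.

Section KerIm.
Variables (R : comNzRingType) (U V : lmodType R) (f : {linear U -> V}).

Definition ker_sub : submodule U.
Proof.
exists (fun x => f x = 0); first exact: linear0.
by move=> a x y fx fy; rewrite linearP fx fy scaler0 addr0.
Defined.

Definition im_sub : submodule V.
Proof.
exists (fun y => exists x, f x = y); first by exists 0; apply: linear0.
by move=> a _ _ [x <-] [y <-]; exists (a *: x + y); rewrite linearP.
Defined.

Definition preim_sub (S : submodule V) : submodule U.
Proof.
exists (fun x => S (f x)); first by rewrite linear0; apply: smem0.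
by move=> a x y Sx Sy; rewrite linearP; apply: smemL.
Defined.

End KerIm.

Lemma factor_surj (R : comNzRingType) (U V W : lmodType R)
    (p : {linear U -> V}) (f : {linear U -> W}) :
  surj p -> (forall x, p x = 0 -> f x = 0) ->
  exists g : {linear V -> W}, forall x, g (p x) = f x.
Proof.
move=> ps pf; have [s sK] := choice ps.
have fE x y : p x = p y -> f x = f y.
  by move=> pxy; apply/subr0_eq; rewrite -linearB pf // linearB pxy subrr.
have gL : linear (f \o s).
  by move=> a x y; rewrite /= -linearP; apply: fE; rewrite linearP !sK.
by exists (mklin gL) => x; rewrite mklinE; apply: fE; rewrite sK.
Qed.

Lemma factor_inj (R : comNzRingType) (U V W : lmodType R)
    (i : {linear V -> W}) (f : {linear U -> W}) :
  injective i -> (forall x, exists y, i y = f x) ->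
  exists g : {linear U -> V}, forall x, i (g x) = f x.
Proof.
move=> ii /choice[g gE].
have gL : linear g by move=> a x y; apply: ii; rewrite linearP !gE linearP.
by exists (mklin gL).
Qed.

Section Free.
Variables (A : comNzRingType) (T : choiceType).

Definition freemod : lmodType A := {malg A[T]}.
Definition fbasis (t : T) : freemod := << 1 *g t >>.
Definition fcoef (t : T) (x : freemod) : A := mcoeff t x.

Lemma fcoefD t x y : fcoef t (x + y) = fcoef t x + fcoef t y.
Proof. exact: mcoeffD. Qed.
Lemma fcoefZ t a x : fcoef t (a *: x) = a * fcoef t x.
Proof. exact: mcoeffZ. Qed.
Lemma fcoef0 t : fcoef t 0 = 0.
Proof. exact: mcoeff0. Qed.
Lemma fcoef_linear t : linear (fcoef t : freemod -> A^o).
Proof. by move=> a x y; rewrite fcoefD fcoefZ. Qed.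
Definition fcoord t : {linear freemod -> A^o} := mklin (fcoef_linear t).

Lemma fcoef_basis t u : fcoef t (fbasis u) = (u == t)%:R.
Proof. by rewrite /fcoef mcoeffU. Qed.

Lemma free_ext (x y : freemod) : (forall t, fcoef t x = fcoef t y) -> x = y.
Proof. by move=> xy; apply/malgP. Qed.

(** The range may be any finite set containing the support, so that several
    elements can be expanded over a common range. *)
Lemma free_sum (x : freemod) (d : {fset T}) : (msupp x `<=` d)%fset ->
  x = \sum_(t <- d) fcoef t x *: fbasis t.
Proof.
move=> xd; rewrite {1}(monalgEw xd); apply: eq_bigr => t _.
apply: free_ext => u; rewrite fcoefZ fcoef_basis /fcoef mcoeffU.
by rewrite mulr_natr.
Qed.

Section Lift.
Variables (V : lmodType A) (phi : T -> V).

Lemma free_lift : exists f : {linear freemod -> V}, forall t, f (fbasis t) = phi t.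
Proof.
pose f (x : freemod) := \sum_(t <- msupp x) fcoef t x *: phi t.
have fE (x : freemod) (d : {fset T}) : (msupp x `<=` d)%fset ->
    f x = \sum_(t <- d) fcoef t x *: phi t.
  move=> xd; rewrite /f (big_fset_incl _ xd) //= => t _ /mcoeff_outdom.
  by rewrite /fcoef => ->; rewrite scale0r.
have fL : linear f.
  move=> a x y.
  pose d := (msupp (a *: x + y)%R `|` (msupp x `|` msupp y))%fset.
  have dxy : (msupp (a *: x + y)%R `<=` d)%fset by apply: fsubsetUl.
  have dx : (msupp x `<=` d)%fset by rewrite /d fsetUCA; apply: fsubsetUl.
  have dy : (msupp y `<=` d)%fset by rewrite /d fsetUA; apply: fsubsetUr.
  rewrite (fE _ _ dxy) (fE _ _ dx) (fE _ _ dy).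
  rewrite scaler_sumr -big_split; apply: eq_bigr => t _ /=.
  by rewrite fcoefD fcoefZ scalerDl scalerA.
exists (mklin fL) => t; rewrite mklinE.
rewrite (fE (fbasis t) [fset t]%fset) ?msuppU_le //.
by rewrite big_seq_fset1 fcoef_basis eqxx scale1r.
Qed.
End Lift.

Lemma free_eq (V : lmodType A) (f g : {linear freemod -> V}) :
  (forall t, f (fbasis t) = g (fbasis t)) -> f =1 g.
Proof.
move=> fg x; rewrite (free_sum (fsubset_refl (msupp x))) !linear_sum.
by apply: eq_bigr => t _; rewrite !linearZ fg.
Qed.

Lemma free_ind (S : submodule freemod) : (forall t, S (fbasis t)) -> forall x, S x.
Proof.
move=> Sb x; rewrite (free_sum (fsubset_refl (msupp x))).
by apply: smem_sum => t; apply: smemZ.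
Qed.

Lemma free_projective : projective freemod.
Proof.
move=> U V g f gs; have [s sK] := choice (fun t : T => gs (f (fbasis t))).
have [h hE] := free_lift s; exists h => x.
by have /= -> := @free_eq V (g \o h) f _ x => // t /=; rewrite hE sK.
Qed.

End Free.

(** * Perfect rings *)

Section Perfect.
Variable A : comNzRingType.

Lemma superfluous_sub (P : lmodType A) (K : P -> Prop) (L : submodule P) :
  superfluous K -> (forall x, exists y z, [/\ L y, K z & x = y + z]) ->
  forall x, L x.
Proof.
move=> Ks LK x; apply/asboolP; apply: (Ks (smemb L)) => [|u].
  exact: smemb_closed.
by have [y [z [Ly Kz ->]]] := LK u; exists y, z; split=> //; apply/asboolP.
Qed.

(** Since [f] is the identity modulo the superfluous kernel it is onto, hence
    split by some [g]; the image of [g] again fills [P] modulo the kernel, so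
    [g] is onto too. *)
Lemma superfluous_endo_inj (P M : lmodType A) (p : {linear P -> M})
    (f : {linear P -> P}) :
  projective_cover p -> (forall y, p (f y) = p y) -> injective f.
Proof.
move=> [Pp _ Ks] pf.
have fs : surj f.
  move=> y; apply: (superfluous_sub (L := im_sub f) Ks) => x.
  exists (f x), (x - f x); split; first by exists x.
    by rewrite linearB pf subrr.
  by rewrite addrC subrK.
have [g fg] := Pp _ _ f idfun fs.
have gs : surj g.
  move=> y; apply: (superfluous_sub (L := im_sub g) Ks) => x.
  exists (g (f x)), (x - g (f x)); split; first by exists (f x).
    by rewrite linearB -(pf (g _)) fg /= pf subrr.
  by rewrite addrC subrK.
move=> x y; have [u <-] := gs x; have [v <-] := gs y.
by rewrite !fg /= => ->.
Qed.

(** A flat module with a projective cover is projective.  Flatness of [F/L] is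
    expressed by the last hypothesis (Villamayor): each element of [L] is fixed
    by an endomorphism of [F] with values in [L].  If [p : P -> F/L] is a
    projective cover, [phi : F -> P] and [psi : P -> F] are lifts over [F/L],
    and [p x = 0], choose [f] fixing [psi x]; then
    [phi psi - phi f psi] is an endomorphism over [F/L] killing [x], so
    [x = 0].  Hence [p] is an isomorphism and [1 - psi phi] retracts [F] to [L]. *)
Lemma perfect_retract (F : lmodType A) (L : submodule F) :
    perfect_ring A -> projective F ->
    (forall x, L x -> exists2 f : {linear F -> F}, (forall y, L (f y)) & f x = x) ->
  exists2 f : {linear F -> F}, (forall y, L (f y)) & forall x, L x -> f x = x.
Proof.
move=> pA Fp LV; have [P [p pc]] := pA (quotmod L).
have [Pp ps _] := pc.
have [phi phiE] := Fp _ _ p (quotpi L) ps.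
have [psi psiE] := Pp _ _ (quotpi L) p (@quotpi_surj _ _ L).
have p0 x : p x = 0 -> x = 0.
  move=> px0.
  have /LV[f fL fx] : L (psi x) by apply/quotpi_eq0; rewrite psiE.
  pose b : {linear P -> P} := (phi \o psi) \- (phi \o f \o psi).
  have bE y : b y = phi (psi y) - phi (f (psi y)) by [].
  have pb y : p (b y) = p y.
    rewrite bE linearB !phiE psiE.
    by have /quotpi_eq0 -> := fL (psi y); rewrite subr0.
  by apply: (superfluous_endo_inj pc pb); rewrite linear0 bE fx subrr.
pose rho : {linear F -> F} := idfun \- (psi \o phi).
have rhoE x : rho x = x - psi (phi x) by [].
exists rho => [x|x Lx]; rewrite rhoE.
  by apply/quotpi_eq0; rewrite linearB psiE phiE subrr.
have -> : phi x = 0 by apply: p0; rewrite phiE; apply/quotpi_eq0.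
by rewrite linear0 subr0.
Qed.

(** The Bass module of a sequence [a] is the direct limit of copies of [A] with
    transition maps [a 0, a 1, ...].  It is the quotient of the free module on
    [nat] by [bass_sub]: the elements that die once everything is pushed to a
    late enough stage. *)
Section Bass.
Variable a : nat -> A.

Definition bass_prod j n := \prod_(j <= i < n) a i.

(** The image of [x] in the [n]-th copy of [A], meaningful when the support of
    [x] lies below [n]. *)
Definition bass_fun n (x : freemod A nat) :=
  \sum_(j < n) fcoef (j : nat) x * bass_prod j n.

Definition bass_mem (x : freemod A nat) := exists2 n : nat,
  (forall j, (n <= j)%N -> fcoef j x = 0) & bass_fun n x = 0.

Lemma bass_funS n (x : freemod A nat) : (forall j, (n <= j)%N -> fcoef j x = 0) ->
  bass_fun n.+1 x = bass_fun n x * a n.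
Proof.
move=> x0; rewrite /bass_fun big_ord_recr /= x0 // mul0r addr0 mulr_suml.
by apply: eq_bigr => i _; rewrite /bass_prod big_nat_recr ?mulrA // ltnW.
Qed.

Lemma bass_widen n m (x : freemod A nat) :
  (forall j, (n <= j)%N -> fcoef j x = 0) ->
  (n <= m)%N -> bass_fun n x = 0 -> bass_fun m x = 0.
Proof.
move=> x0 /subnKC <- e; elim: (m - n)%N => [|k IH]; first by rewrite addn0.
rewrite addnS bass_funS ?IH ?mul0r // => j le_j.
by apply: x0; apply: leq_trans le_j; apply: leq_addr.
Qed.

Lemma bass_fun_linear n : linear (bass_fun n : freemod A nat -> A^o).
Proof.
move=> c x y; rewrite /bass_fun scaler_sumr -big_split; apply: eq_bigr => i _ /=.
by rewrite fcoefD fcoefZ mulrDl -mulrA.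
Qed.

Definition bass_sub : submodule (freemod A nat).
Proof.
exists bass_mem.
  exists 0%N => [j _|]; first by rewrite /fcoef mcoeff0.
  by rewrite /bass_fun big_ord0.
move=> c x y [n xn fx] [m ym fy]; exists (maxn n m) => [j|].
  by rewrite geq_max => /andP[nj mj]; rewrite fcoefD fcoefZ xn ?ym // mulr0 addr0.
rewrite bass_fun_linear (bass_widen xn _ fx) ?leq_maxl //.
by rewrite (bass_widen ym _ fy) ?leq_maxr // scaler0 addr0.
Defined.

Lemma bass_fun_basis j n : (j < n)%N -> bass_fun n (fbasis A j) = bass_prod j n.
Proof.
move=> jn; rewrite /bass_fun (bigD1 (Ordinal jn)) //= fcoef_basis eqxx mul1r.
rewrite big1 ?addr0 // => i; rewrite fcoef_basis -val_eqE /= eq_sym => /negPf ->.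
by rewrite mul0r.
Qed.

Lemma bass_rel j n : (j <= n)%N ->
  bass_mem (fbasis A j - bass_prod j n *: fbasis A n).
Proof.
move=> jn; exists n.+1 => [i ni|].
  rewrite -scaleNr fcoefD fcoefZ !fcoef_basis !ltn_eqF ?mulr0 ?addr0 //.
  exact: leq_ltn_trans ni.
rewrite addrC -scaleNr bass_fun_linear !bass_fun_basis // scaleNr.
rewrite addrC; apply/eqP; rewrite subr_eq0; apply/eqP.
by rewrite /bass_prod big_nat_recr //= big_nat1.
Qed.

(** The Bass module splits off by [perfect_retract].  The section maps the class
    of the first basis vector to some [s], all of whose coefficients are
    divisible by every product [a 0 ... a (n - 1)]; as [s] represents that
    class, some product [a 0 ... a N] is a combination of its coefficients. *)
Lemma perfect_dcc : perfect_ring A ->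
  exists m, forall n, exists c, bass_prod 0 m = c * bass_prod 0 n.
Proof.
move=> pA.
have [|f fL fid] := perfect_retract (L := bass_sub) pA (@free_projective A nat).
  move=> x [N xN fx].
  have [f fE] := free_lift (fun j : nat =>
    if (j < N)%N then fbasis A j - bass_prod j N *: fbasis A N else 0).
  exists f.
    (* below N, f subtracts from a basis vector its image at stage N *)
    apply: (free_ind (S := preim_sub f bass_sub)) => j /=; rewrite fE.
    by case: ifP => [/ltnW/bass_rel//|_]; apply: (smem0 bass_sub).
  have xE : x = \sum_(j < N) fcoef (j : nat) x *: @fbasis A nat j.
    apply: free_ext => j; rewrite -[RHS]/(fcoord A j _) linear_sum /=.
    case: (ltnP j N) => jN; last first.
      rewrite xN // big1 // => i _; rewrite fcoefZ fcoef_basis ltn_eqF ?mulr0 //.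
      exact: leq_trans jN.
    rewrite (bigD1 (Ordinal jN)) //= fcoefZ fcoef_basis eqxx mulr1.
    rewrite big1 ?addr0 // => i; rewrite -val_eqE /= fcoefZ fcoef_basis.
    by move=> /negPf ->; rewrite mulr0.
  rewrite {2}xE {1}xE linear_sum; apply/subr0_eq; rewrite -sumrB.
  rewrite (eq_bigr (fun j : 'I_N =>
    (- (fcoef (j : nat) x * bass_prod j N)) *: fbasis A N)).
    by rewrite -scaler_suml sumrN -/(bass_fun N x) fx oppr0 scale0r.
  move=> j _; rewrite linearZ /= fE ltn_ord scalerBr addrAC subrr add0r.
  by rewrite scaleNr scalerA.
pose s : {linear freemod A nat -> freemod A nat} := idfun \- f.
have sE x : s x = x - f x by [].
have sZ n : s (fbasis A 0%N) = bass_prod 0 n *: s (fbasis A n).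
  apply/subr0_eq; rewrite -linearZ -linearB sE fid ?subrr //.
  exact: (bass_rel (leq0n n)).
have [N N0 fN] : bass_mem (fbasis A 0%N - s (fbasis A 0%N)).
  by rewrite sE opprB addrC subrK; apply: fL.
exists N.+1 => n.
have : bass_prod 0 N.+1 = bass_fun N.+1 (s (fbasis A 0%N)).
  apply/subr0_eq; rewrite -(@bass_fun_basis 0 N.+1) //.
  rewrite -[LHS](linearB (mklin (@bass_fun_linear N.+1))).
  exact: bass_widen fN.
rewrite (sZ n) => ->; exists (bass_fun N.+1 (s (fbasis A n))).
by rewrite [LHS](linearZ_LR (mklin (@bass_fun_linear N.+1))) /= mulrC.
Qed.
End Bass.
End Perfect.

(** * Simple submodules of the quotients of an almost perfect domain *)

Section Ideals.
Variable R : comNzRingType.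

Definition ideal := submodule (R^o : lmodType R).

Implicit Types I J : ideal.

Lemma idealMl I a x : I x -> I (a * x).
Proof. exact: (@smemZ _ _ I a x). Qed.

Definition principal (r : R) : ideal.
Proof.
exists (fun x => exists c, x = c * r); first by exists 0; rewrite mul0r.
move=> a _ _ [c ->] [d ->]; exists (a * c + d).
by rewrite mulrDl -mulrA.
Defined.

Lemma principal_id r : principal r r.
Proof. by exists 1; rewrite mul1r. Qed.

Lemma idealr_of I : ~ I 1 -> exists J : idealr R, forall x, x \in J <-> I x.
Proof.
move=> I1.
have cl : idealr_closed (smemb I : {pred R}).
  split; first exact/asboolP/(smem0 I).
    by apply/asboolP.
  by move=> a u v /asboolP Iu /asboolP Iv; apply/asboolP/(smemL a Iu Iv).
pose J : idealr R := HB.pack (smemb I : {pred R}) (isIdealr.Build R (smemb I) cl).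
by exists J => x; split=> /asboolP.
Qed.

Lemma ideal_piE (J : idealr R) (x y : R) :
  \pi_({ideal_quot J}) x = \pi_({ideal_quot J}) y <-> x - y \in J.
Proof. by rewrite Quotient.idealrBE; split=> /eqP. Qed.

End Ideals.

Section AlmostPerfect.
Variable R : idomainType.
Hypothesis hR : almost_perfect_domain R.

Implicit Types I J : ideal R.

Lemma perfect_quotient I x : ~ I 1 -> I x -> x != 0 ->
  exists2 A : comNzRingType, perfect_ring A & exists2 p : {rmorphism R -> A},
    surj p & forall y, p y = 0 <-> I y.
Proof.
move=> /idealr_of[J JE] Ix x0; exists {ideal_quot J}.
  by apply: hR; exists x => //; apply/JE.
pose p (y : R) : {ideal_quot J} := \pi y.
have pB : zmod_morphism p.
  by move=> u v; rewrite /p -[u - v]/(u + - v) pi_addr pi_oppr.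
have pM : monoid_morphism p.
  by split; [apply: pi_oner | move=> u v; apply: pi_mulr].
pose q : {rmorphism R -> {ideal_quot J}} := HB.pack p
  (GRing.isZmodMorphism.Build R _ p pB) (GRing.isMonoidMorphism.Build R _ p pM).
exists q => [y|y]; first by exists (repr y); rewrite /q /= /p reprK.
rewrite -JE -[X in X \in J](subr0 y) -ideal_piE.
by rewrite -[\pi 0]/(q 0) rmorph0.
Qed.

Lemma chain_stable I x (y : nat -> R) : I x -> x != 0 ->
  exists m c, I (\prod_(j < m) y j - c * \prod_(j < m.+1) y j).
Proof.
move=> Ix x0; case: (pselect (I 1)) => [I1|I1].
  by exists 0%N, 0; rewrite -[X in I X]mulr1; apply: idealMl.
have [A pA [p ps pI]] := perfect_quotient I1 Ix x0.
have [m mE] := perfect_dcc (p \o y) pA; have [c cE] := mE m.+1.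
have [d dE] := ps c; exists m, d; apply/pI.
have pE n : p (\prod_(j < n) y j) = bass_prod (p \o y) 0 n.
  by rewrite rmorph_prod /bass_prod big_mkord.
by rewrite rmorphB rmorphM !pE dE -cE subrr.
Qed.

(** Descending chain condition on principal ideals of [R/I], as a minimum
    principle.  The property [G] must hold again for the multiples along a
    putative descending chain, whence the relative form of minimality. *)
Lemma principal_min I x (G : R -> Prop) : I x -> x != 0 -> (exists y, G y) ->
  exists2 z, G z & forall y, G (y * z) -> exists u, I (z - u * (y * z)).
Proof.
move=> Ix x0 [y0 Gy0]; apply: contrapT => none.
have step (z : {z | G z}) : exists y, G (y * sval z) /\
    forall u, ~ I (sval z - u * (y * sval z)).
  apply: contrapT => noy; apply: none; exists (sval z); first exact: svalP.
  move=> y Gy; apply: contrapT => nou; apply: noy; exists y; split=> // u Iu.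
  by apply: nou; exists u.
have [y yE] := choice step.
pose nxt (z : {z | G z}) : {z | G z} := exist _ _ (yE z).1.
pose z n := iter n nxt (exist _ _ Gy0).
have [m [c Ic]] := chain_stable (fun n => y (z n)) Ix x0.
have zE n : sval (z n) = \prod_(j < n) y (z j) * y0.
  elim: n => [|n IH]; first by rewrite big_ord0 mul1r.
  by rewrite /= -/(z n) IH big_ord_recr /= mulrA [_ * y (z n)]mulrC.
apply: (yE (z m)).2 (c) _; rewrite -[y _ * _]/(sval (z m.+1)) !zE.
by rewrite mulrA -mulrBl mulrC; apply: idealMl.
Qed.

(** Both classes, that of [x] modulo [J] and that of [a] modulo [r], span a
    simple module with the same annihilator.  Minimality of [x] among elements
    outside [J] makes p = (J : x) maximal.  As [r] one takes an element of [J],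
    which lies in p, and as [a] a minimal element among those with (r : a)
    contained in p, that is, those not killed by localizing [R/r] at p. *)
Lemma common_simple J j : J j -> j != 0 -> ~ J 1 ->
  exists x r a, [/\ ~ J x, r != 0 & forall b, J (b * x) <-> principal r (b * a)].
Proof.
move=> Jj j0 J1.
have [x Jx xmin] := principal_min Jj j0 (ex_intro (fun x => ~ J x) _ J1).
have pmax y : ~ J (y * x) -> exists u, J (x - u * (y * x)) by apply: xmin.
pose good a := forall b, principal j (b * a) -> J (b * x).
have good1 : good 1.
  by move=> b [c]; rewrite mulr1 => ->; rewrite mulrC; do 2!apply: idealMl.
have [a ga amin] := principal_min (principal_id j) j0 (ex_intro good _ good1).
exists x, j, a; split=> // b; split=> [Jbx|/ga//].
(* otherwise 1 - u b kills a modulo j for some u, although b is in p *)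
have : ~ good (b * a).
  move=> /amin[u]; rewrite -{1}[a]mul1r mulrA -mulrBl => /ga; rewrite mulrBl mul1r.
  move=> Jx'; apply: Jx; rewrite -[x](subrK (u * b * x)); apply: smemD => //.
  by rewrite -mulrA; apply: idealMl.
move=> /existsNP[s /not_implyP[sba /pmax[u Ju]]].
(* s is outside the prime ideal p, so multiplying by it preserves good *)
have /amin[v] : good (s * a).
  move=> t; rewrite mulrA => /ga Jts; rewrite -[t * x](subrK (u * (t * s * x))).
  apply: smemD; last exact: idealMl.
  have -> : t * x - u * (t * s * x) = t * (x - u * (s * x)) by ring.
  exact: idealMl.
move=> /(idealMl b).
  have -> : b * (a - v * (s * a)) = b * a - v * (s * (b * a)) by ring.
move=> bav; rewrite -[b * a](subrK (v * (s * (b * a)))); apply: smemD => //.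
exact: idealMl.
Qed.
End AlmostPerfect.

Local Open Scope classical_set_scope.

(** * Extending homomorphisms by Zorn's lemma *)

(** Apply Zorn's lemma to the sets [A] with [P (A0 `|` A)], which makes the
    empty chain harmless. *)
Lemma zorn_above (T : Type) (P : set (set T)) (A0 : set T) : P A0 ->
  (forall F : set (set T), F !=set0 -> F `<=` P -> total_on F subset ->
     P (\bigcup_(X in F) X)) ->
  exists A, [/\ P A, A0 `<=` A & forall B, A `<=` B -> P B -> B `<=` A].
Proof.
move=> PA0 Pch.
have [|A [PA Amax]] := @Zorn_bigcup T (fun A => P (A0 `|` A)).
  move=> F FP Ftot; have [[X0 FX0]|F0] := pselect (F !=set0); last first.
    have -> : F = set0 by apply/seteqP; split=> // X FX; case: F0; exists X.
    by rewrite bigcup_set0 setU0.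
  have -> : A0 `|` \bigcup_(X in F) X = \bigcup_(Y in [set A0 `|` X | X in F]) Y.
    apply/seteqP; split=> [x [A0x|[X FX Xx]]|x [_ [X FX <-]] [A0x|Xx]].
    - by exists (A0 `|` X0); [exists X0 | left].
    - by exists (A0 `|` X); [exists X | right].
    - by left.
    - by right; exists X.
  apply: Pch; first by exists (A0 `|` X0), X0.
    by move=> _ [X FX <-]; apply: FP.
  move=> _ _ [X FX <-] [Y FY <-].
  by case: (Ftot X Y FX FY) => XY; [left | right]; apply: setUS.
exists (A0 `|` A); split=> // B AB PB x Bx; apply: contrapT => Ax.
apply: (Amax B); last by rewrite setUidr // => y A0y; apply: AB; left.
split; last by move=> /(_ x Bx) ?; apply: Ax; right.
by move=> y Ay; apply: AB; right.
Qed.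

(** Partial homomorphisms are total functions that are linear on their domain,
    which spares dependent types when the domain grows. *)
Definition linear_on (R : comNzRingType) (B C : lmodType R) (U : B -> Prop)
    (f : B -> C) :=
  forall a x y, U x -> U y -> f (a *: x + y) = a *: f x + f y.

Lemma linear_on_sub (R : comNzRingType) (B C : lmodType R) (U : submodule B)
  (f : B -> C) : linear_on U f ->
  exists g : {linear submod U -> C}, forall x, g x = f (subinj U x).
Proof.
move=> fL; have gL : linear (f \o subinj U).
  by move=> a x y; rewrite /= -fL ?linearP //; apply: subinjP.
by exists (mklin gL).
Qed.

Lemma linear_onB (R : comNzRingType) (B C : lmodType R) (U : submodule B)
  (f : B -> C) x y : linear_on U f -> U x -> U y -> f (x - y) = f x - f y.
Proof. by move=> fL Ux Uy; rewrite -scaleN1r addrC fL // scaleN1r addrC. Qed.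

Lemma linear_on0 (R : comNzRingType) (B C : lmodType R) (U : submodule B)
  (f : B -> C) : linear_on U f -> f 0 = 0.
Proof.
by move=> fL; rewrite -[X in f X](subrr 0) (linear_onB fL) ?subrr //; apply: smem0.
Qed.

Section HomExtension.
Variables (R : comNzRingType) (B C : lmodType R).
Variables (Pd : set B -> Prop) (U0 : submodule B) (f0 : B -> C).
Hypothesis f0L : linear_on U0 f0.
Hypothesis PdU0 : Pd U0.
Hypothesis Pd_chain : forall F : set (set B), F !=set0 -> F `<=` Pd ->
  total_on F subset -> Pd (\bigcup_(X in F) X).
Hypothesis Pd_step : forall (U : submodule B) (f : B -> C) x,
    Pd U -> linear_on U f -> ~ U x ->
  exists (V : submodule B) g, [/\ (U : set B) `<=` V, exists2 y, V y & ~ U y, Pd V,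
    linear_on V g & forall y, U y -> g y = f y].

Definition partial_graph (G : set (B * C)) := exists (U : submodule B) (f : B -> C),
  [/\ Pd U, linear_on U f, (U0 : set B) `<=` U, forall x, U0 x -> f x = f0 x
    & G = [set z | U z.1 /\ z.2 = f z.1]].

Lemma partial_graph_chain (F : set (set (B * C))) : F !=set0 ->
  F `<=` partial_graph -> total_on F subset -> partial_graph (\bigcup_(X in F) X).
Proof.
move=> [G0 FG0] FP Ftot; pose G := \bigcup_(X in F) X.
have Gdir z w : G z -> G w -> exists2 X, F X & X z /\ X w.
  move=> [X FX Xz] [Y FY Yw].
  by case: (Ftot X Y FX FY) => XY; [exists Y | exists X] => //;
    split=> //; apply: XY.
have Gfun x c d : G (x, c) -> G (x, d) -> c = d.
  move=> Gc /(Gdir _ _ Gc)[X /FP[U [f [_ _ _ _ ->]]] [[_ /= ->] [_ /= ->]]] //.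
have GL a x y c d : G (x, c) -> G (y, d) -> G (a *: x + y, a *: c + d).
  move=> Gc /(Gdir _ _ Gc)[X FX]; have [U [f [_ fL _ _ XE]]] := FP X FX.
  rewrite XE /= => -[[Ux ->] [Uy ->]]; exists X => //; rewrite XE /=.
  by split; [apply: smemL | rewrite fL].
have G00 : G (0, 0).
  exists G0 => //; have [U [f [_ fL _ _ ->]]] := FP _ FG0.
  split; first exact: smem0.
  by rewrite /= (linear_on0 fL).
have domL a x y : (exists c, G (x, c)) -> (exists c, G (y, c)) ->
    exists c, G (a *: x + y, c).
  by move=> [c Gc] [d Gd]; exists (a *: c + d); apply: GL.
pose U := @Submodule _ B (fun x => exists c, G (x, c)) (ex_intro _ 0 G00) domL.
have /choice[f fE] : forall x, exists c, U x -> G (x, c).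
  by move=> x; have [[c Gc]|nU] := pselect (U x); [exists c | exists 0].
exists U, f; split.
- have -> : (U : set B) = \bigcup_(V in [set [set z.1 | z in X] | X in F]) V.
    apply/seteqP; split=> [x [c [X FX Xc]]|x [_ [X FX <-]] [[y c] Xz <-]].
      by exists [set z.1 | z in X]; [exists X | exists (x, c)].
    by exists c, X.
  apply: Pd_chain.
  + by exists [set z.1 | z in G0], G0.
  + move=> _ [X FX <-]; have [V [g [PV _ _ _ ->]]] := FP X FX.
    rewrite (_ : [set _ | _ in _] = V) //; apply/seteqP.
    by split=> [x [z [Vz _] <-]|x Vx] //; exists (x, g x).
  + move=> _ _ [X FX <-] [Y FY <-].
    by case: (Ftot X Y FX FY) => XY; [left | right]; apply: image_subset.
- move=> a x y Ux Uy; apply: (@Gfun (a *: x + y)).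
    by apply: fE; apply: smemL.
  by apply: GL; apply: fE.
- move=> x U0x; have [V [g [_ _ U0V _ GE]]] := FP _ FG0.
  by exists (g x), G0 => //; rewrite GE; split=> //; apply: U0V.
- move=> x U0x; have [V [g [_ _ U0V gE GE]]] := FP _ FG0.
  have Gx : G (x, g x) by exists G0; rewrite // GE; split=> //; apply: U0V.
  by rewrite -gE //; apply: (Gfun x) => //; apply: fE; exists (g x).
- apply/seteqP; split=> -[x c] /= => [Gx|[Ux ->]]; last exact: fE.
  have Ux : U x by exists c.
  by split=> //; apply: (Gfun x) => //; apply: fE.
Qed.

(** The property [Pd] of the domains allows the extension step to use a
    hypothesis (such as flatness) that has to be carried along the chain. *)
Lemma hom_extension : exists h : {linear B -> C}, forall x, U0 x -> h x = f0 x.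
Proof.
have [|G [[U [f [PU fL U0U fE GE]]] _ Gmax]] :=
    @zorn_above _ partial_graph [set z | U0 z.1 /\ z.2 = f0 z.1] _
      partial_graph_chain.
  by exists U0, f0; split.
have UT x : U x.
  apply: contrapT => nUx.
  have [V [g [UV [y Vy nUy] PV gL gE]]] := Pd_step PU fL nUx.
  have : G (y, g y).
    apply: (Gmax [set z | V z.1 /\ z.2 = g z.1]) => //; last first.
      exists V, g; split=> // z U0z; first exact/UV/U0U.
      by rewrite gE ?fE //; apply: U0U.
    by rewrite GE => -[z c] /= [Uz ->]; rewrite gE //; split=> //; apply: UV.
  by rewrite GE => -[].
by exists (mklin (fun a x y => fL a x y (UT x) (UT y))) => x U0x; rewrite mklinE fE.
Qed.

End HomExtension.

Section Adjoin.
Variables (R : comNzRingType) (B C : lmodType R) (U : submodule B) (x : B).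

Definition adjoin : submodule B.
Proof.
exists (fun y => exists b, U (y - b *: x)).
  by exists 0; rewrite scale0r subr0; apply: smem0.
move=> a y z [b Ub] [c Uc]; exists (a * b + c).
rewrite scalerDl -scalerA opprD addrACA -scalerBr; exact: smemL.
Defined.

Lemma adjoin_sub y : U y -> adjoin y.
Proof. by exists 0; rewrite scale0r subr0. Qed.

Lemma adjoin_mem : adjoin x.
Proof. by exists 1; rewrite scale1r subrr; apply: smem0. Qed.

Lemma adjoin_hom (f : B -> C) c : linear_on U f ->
  (forall b, U (b *: x) -> f (b *: x) = b *: c) ->
  exists g, [/\ linear_on adjoin g, forall y, U y -> g y = f y & g x = c].
Proof.
move=> fL fc.
have /choice[s sE] : forall y, exists b, adjoin y -> U (y - b *: x).
  by move=> y; have [[b Ub]|nUy] := pselect (adjoin y); [exists b | exists 0].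
pose g y := f (y - s y *: x) + s y *: c.
have gE y b : U (y - b *: x) -> g y = f (y - b *: x) + b *: c.
  move=> Ub; have Us : U (y - s y *: x) by apply: sE; exists b.
  have d : (b - s y) *: x = (y - s y *: x) - (y - b *: x).
    by rewrite [RHS]addrC opprB addrA subrK scalerBl.
  have := fc (b - s y); rewrite d (linear_onB fL) // => /(_ (smemB Us Ub)) e.
  rewrite /g -[f (y - s y *: x)](subrK (f (y - b *: x))) e scalerBl.
  by rewrite addrAC subrK addrC.
exists g; split=> [a y z Vy Vz|y Uy|]; last 2 first.
- by rewrite (gE y 0) !scale0r subr0 ?addr0.
- have Uxx : U (x - 1 *: x) by rewrite scale1r subrr; apply: smem0.
  by rewrite (gE x 1 Uxx) !scale1r subrr (linear_on0 fL) add0r.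
have e : a *: y + z - (a * s y + s z) *: x = a *: (y - s y *: x) + (z - s z *: x).
  by rewrite scalerDl -scalerA opprD addrACA -scalerBr.
rewrite (gE (a *: y + z) (a * s y + s z)) e; last by apply: smemL; apply: sE.
rewrite fL; try exact: sE.
by rewrite scalerDl -scalerA addrACA -scalerDr.
Qed.

End Adjoin.

(** * Injective modules *)

Section Divisible.
Variable R : idomainType.

Definition divisible (M : lmodType R) :=
  forall r : R, r != 0 -> surj (fun x : M => r *: x).

Lemma injective_divisible (M : lmodType R) : injective_module M -> divisible M.
Proof.
move=> Mi r r0 y.
have mL : linear ( *%R r : R^o -> R^o) by move=> a u v; rewrite mulrDr mulrCA.
have yL : linear (fun a : R^o => a *: y) by move=> a u v; rewrite scalerDl -scalerA.
have [h hE] := Mi _ _ (mklin mL) (mklin yL) (mulfI r0).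
exists (h (1 : R^o)); have := hE 1; rewrite /= scale1r => <-.
by rewrite -linearZ_LR.
Qed.

Lemma divisible_surj (M N : lmodType R) (f : {linear M -> N}) :
  divisible M -> surj f -> divisible N.
Proof.
move=> dM fs r r0 y; have [x <-] := fs y; have [z <-] := dM r r0 x.
by exists (f z); rewrite linearZ.
Qed.

Hypothesis hR : almost_perfect_domain R.

Section Kernel.
Variables (C E0 E1 : lmodType R) (i : {linear C -> E0}) (q : {linear E0 -> E1}).
Hypotheses (ii : injective i) (qs : surj q) (iq : exact_at i q).
Hypotheses (dC : divisible C).
Hypotheses (E1i : injective_module E1) (E0i : injective_module E0).

Lemma torsion_lift (r : R) e : r != 0 -> r *: e = 0 ->
  exists2 e', q e' = e & r *: e' = 0.
Proof.
move=> r0 re; have [u ue] := qs e.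
have /iq[c ce] : q (r *: u) = 0 by rewrite linearZ ue.
have [d dc] := dC r0 c; exists (u - i d).
  rewrite linearB ue (_ : q (i d) = 0) ?subr0 //; apply/iq; by exists d.
by rewrite scalerBr -linearZ dc ce subrr.
Qed.

(** Surjectivity of Hom(S, E0) -> Hom(S, E1) for the cyclic module [S] spanned by
    the class of [a] in [R/r].  Injectivity of [E1] extends a map from [S] to
    [R/r], where [torsion_lift] applies. *)
Lemma annihilated_lift (r a : R) e : r != 0 ->
  (forall b, principal r (b * a) -> b *: e = 0) ->
  exists2 e', q e' = e & forall b, principal r (b * a) -> b *: e' = 0.
Proof.
move=> r0 ae.
have eL : linear_on (principal r) (fun _ : R^o => 0 : E1).
  by move=> *; rewrite scaler0 addr0.
have [|g [gL g0 ga]] := adjoin_hom (x := a : R^o) (c := e) eL.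
  by move=> b /ae.
have [g' g'E] := linear_on_sub gL.
have [h hE] := E1i g' (@subinj_inj _ _ (adjoin (principal r) (a : R^o))).
have {g' g'E}hE y : adjoin (principal r) (a : R^o) y -> h y = g y.
  by move=> /subinj_surj[z <-]; rewrite hE g'E.
have h1 (y : R) : h (y : R^o) = y *: h (1 : R^o).
  by rewrite -linearZ_LR; congr (h _); rewrite -[RHS]/(y * 1) mulr1.
have rh1 : r *: h (1 : R^o) = 0.
  rewrite -h1 hE ?g0 //; first exact: principal_id.
  exact/adjoin_sub/principal_id.
have [e1 e1h re1] := torsion_lift r0 rh1.
exists (a *: e1).
  by rewrite linearZ e1h /= -h1 hE //; apply: adjoin_mem.
by move=> b [c bac]; rewrite scalerA bac -scalerA re1 scaler0.
Qed.

Lemma smul_linear (B : lmodType R) (x : B) : linear (fun s : R^o => s *: x).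
Proof. by move=> a u v; rewrite scalerDl scalerA. Qed.

(** Take [y] spanning a simple module [S] over [U].  The extension of [f] with
    values in [E0] sends [y] to an element whose image in [E1] is annihilated
    like [S]; subtracting a lift [e] of that image with the same property
    brings the value back to [C].  If no nonzero multiple of [x] lies in [U],
    the sum is direct and [y = x] is sent to [0]. *)
Lemma kernel_step (B : lmodType R) (U : submodule B) (f : B -> C) x :
    linear_on U f -> ~ U x ->
  exists y c, ~ U y /\ forall b, U (b *: y) -> f (b *: y) = b *: c.
Proof.
move=> fL nUx; pose J : ideal R := preim_sub (mklin (smul_linear x)) U.
have JE b : J b = U (b *: x) by [].
have [[j Jj j0]|J0] := pselect (exists2 j, J j & j != 0); last first.
  exists x, 0; split=> // b Ub; have [->|b0] := eqVneq b 0.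
    by rewrite !scale0r (linear_on0 fL).
  by case: J0; exists b.
have J1 : ~ J 1 by rewrite JE scale1r.
have [y [r [a [nJy r0 ya]]]] := common_simple hR Jj j0 J1.
exists (y *: x).
have [f' f'E] := linear_on_sub fL.
have [G GE] := E0i (i \o f') (@subinj_inj _ _ U).
have {f' f'E}GE z : U z -> G z = i (f z).
  by move=> /subinj_surj[w <-]; rewrite GE /= f'E.
have [|e qe ae] := annihilated_lift (a := a) (e := q (G (y *: x))) r0.
  move=> b /ya; rewrite JE -scalerA => Ub.
  by rewrite -2!linearZ /= GE //; apply/iq; exists (f (b *: (y *: x))).
have /iq[c cE] : q (G (y *: x) - e) = 0 by rewrite linearB qe subrr.
exists c; split=> // b Ub; apply: ii.
rewrite -GE // [G _]linearZ [i _]linearZ /= cE scalerBr.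
by rewrite [b *: e]ae ?subr0 //; apply/ya; rewrite JE -scalerA.
Qed.

Lemma kernel_injective : injective_module C.
Proof.
move=> A B j f ji.
have /choice[f0 f0E] : forall y, exists c, forall x, j x = y -> c = f x.
  move=> y; have [[x <-]|ny] := pselect (exists x, j x = y).
    by exists (f x) => z /ji ->.
  by exists 0 => x jx; case: ny; exists x.
have [||||h hE] := @hom_extension R B C setT (im_sub j) f0.
- by move=> a _ _ [x <-] [y <-]; rewrite -linearP !(f0E _ _ erefl) linearP.
- by [].
- by [].
- move=> U g x _ gL nUx; have [y [c [nUy yc]]] := kernel_step gL nUx.
  have [g' [g'L g'E _]] := adjoin_hom gL yc.
  exists (adjoin U y), g'; split=> //; first exact: adjoin_sub.
  by exists y => //; apply: adjoin_mem.
- by exists h => x; rewrite hE; [apply: f0E | exists x].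
Qed.

End Kernel.
End Divisible.

Section TwoTerm.
Variable R : comNzRingType.

Definition zero_mod : lmodType R := 'rV[R]_0.

Lemma zero_modE (x : zero_mod) : x = 0. Proof. exact: thinmx0. Qed.

Definition zero_map (U V : lmodType R) : {linear U -> V} := \0.

Lemma zero_projective : projective zero_mod.
Proof.
by move=> U V g f _; exists (zero_map _ _) => x; rewrite (zero_modE x) !linear0.
Qed.

Lemma trivial_injective (M : lmodType R) :
  (forall x : M, x = 0) -> injective_module M.
Proof.
move=> M0 U V i f _; exists (zero_map _ _) => x.
by rewrite (M0 (zero_map _ _ _)) (M0 (f x)).
Qed.

Definition two_term (P0 P1 : lmodType R) n : lmodType R :=
  match n with 0%N => P0 | 1%N => P1 | _ => zero_mod end.

Lemma left_dim_le1 (C : lmodType R -> Prop) (M P0 P1 : lmodType R)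
    (i : {linear P1 -> P0}) (p : {linear P0 -> M}) :
  C zero_mod -> C P0 -> C P1 -> injective i -> surj p -> exact_at i p ->
  left_dim_le C 1 M.
Proof.
move=> C0 CP0 CP1 ii ps ip.
pose d n : {linear two_term P0 P1 n.+1 -> two_term P0 P1 n} :=
  match n with 0%N => i | _ => zero_map _ _ end.
exists (two_term P0 P1), d, p; split=> //.
- by case=> [|[|n]].
- case=> [|n] y /=; last first.
    by rewrite (zero_modE y); split=> // _; exists 0; rewrite linear0.
  split=> [iy|[x <-]]; last by rewrite linear0.
  by exists 0; apply: ii; rewrite iy !linear0.
- by case=> [|[|n]] // _ x; apply: zero_modE.
Qed.

Lemma right_dim_le1 (C : lmodType R -> Prop) (M E0 E1 : lmodType R)
    (i : {linear M -> E0}) (q : {linear E0 -> E1}) :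
  C zero_mod -> C E0 -> C E1 -> injective i -> surj q -> exact_at i q ->
  right_dim_le C 1 M.
Proof.
move=> C0 CE0 CE1 ii qs iq.
pose d n : {linear two_term E0 E1 n -> two_term E0 E1 n.+1} :=
  match n with 0%N => q | _ => zero_map _ _ end.
exists (two_term E0 E1), d, i; split=> //.
- by case=> [|[|n]].
- case=> [|n] y /=; first by split=> // _; have [x <-] := qs y; exists x.
  by rewrite (zero_modE y); split=> // _; exists 0; rewrite ?linear0.
- by case=> [|[|n]] // _ x; apply: zero_modE.
Qed.

End TwoTerm.

Section Injective.
Variable R : idomainType.
Hypothesis hR : almost_perfect_domain R.

(** The image of [d i] is the [i]-th cosyzygy; the induction runs downwards from
    [i = n], where it vanishes. *)
Lemma class_I_le1 n (M : lmodType R) : class_I n M -> class_I 1 M.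
Proof.
move=> [E [d [e [Ei ei ed dd E0]]]].
pose C i := submod (im_sub (d i)).
have dim i x : im_sub (d i) (d i x) by exists x.
pose dC i : {linear E i -> C i} := projT1 (cid (corestrict (@dim i))).
have dCE i x : subinj _ (dC i x) = d i x by rewrite /dC; case: cid.
have dCs i : surj (dC i).
  move=> y; have [x xy] := subinjP y; exists x.
  by apply: subinj_inj; rewrite dCE.
have Ci i : injective_module (C i).
  have [k ik] : exists k, (n - i)%N = k by exists (n - i)%N.
  elim: k i ik => [|k IH] i ik.
    apply: trivial_injective => x; apply: subinj_inj; rewrite linear0.
    by apply: E0; rewrite ltnS -subn_eq0 ik.
  apply: (kernel_injective hR (@subinj_inj _ _ (im_sub (d i))) (@dCs i.+1)).
  - move=> y; split=> [dy|[x <-]].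
      have /dd[x xy] : d i.+1 y = 0 by rewrite -dCE dy linear0.
      by apply: subinj_surj; exists x.
    by apply: subinj_inj; rewrite dCE linear0; apply/dd; apply: (subinjP x).
  - exact: divisible_surj (injective_divisible (Ei i)) (@dCs i).
  - by apply: IH; rewrite subnS ik.
  - exact: Ei.
apply: (right_dim_le1 _ (Ei 0%N) (Ci 0%N) ei (@dCs 0%N)).
  by apply/trivial_injective/zero_modE.
move=> y; rewrite -ed; split=> [dy|dy]; first by rewrite -dCE dy linear0.
by apply: subinj_inj; rewrite dCE linear0.
Qed.
End Injective.

(** * Flatness through equations *)

Section Flatness.
Variable R : comNzRingType.

(** The equational criterion, relative to a subset [S] so that it applies to
    submodules, unions of chains of submodules and whole modules alike.
    Letting the auxiliary free module have any basis spares the bookkeeping of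
    matrices. *)
Definition flat_in (V : lmodType R) (S : V -> Prop) : Prop :=
  forall (I : finType) (a : I -> R) (x : I -> V),
    (forall i, S (x i)) -> \sum_i a i *: x i = 0 ->
  exists (T : choiceType) (f : {linear freemod R T -> V}) (u : I -> freemod R T),
    [/\ forall w, S (f w), forall i, f (u i) = x i & \sum_i a i *: u i = 0].

Lemma sum_unit (V : zmodType) (F : unit -> V) : \sum_(i : unit) F i = F tt.
Proof. by rewrite (bigD1 tt) //= big1 ?addr0 // => -[]. Qed.

Definition full_sub (V : lmodType R) : submodule V :=
  @Submodule R V (fun => True) I (fun _ _ _ _ _ => I).

Definition ideal_mul (V : lmodType R) (J : ideal R) (S : submodule V) : submodule V.
Proof.
exists (fun z => exists (I : finType) (c : I -> R) (y : I -> V),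
  [/\ forall i, J (c i), forall i, S (y i) & z = \sum_i c i *: y i]).
  by exists void, (fun=> 0), (fun=> 0); split=> [[]|[]|]; rewrite big1.
move=> a _ _ [I [c [y [Jc Sy ->]]]] [I' [c' [y' [Jc' Sy' ->]]]].
exists (I + I')%type, (fun i => match i with inl i => a * c i | inr i => c' i end),
  (fun i => match i with inl i => y i | inr i => y' i end); split=> [[]i|[]i|] //.
  exact: idealMl.
rewrite big_sumType scaler_sumr; congr (_ + _).
by apply: eq_bigr => i _; rewrite scalerA.
Defined.

Lemma ideal_mul_gen (V : lmodType R) (J : ideal R) (S : submodule V) c y :
  J c -> S y -> ideal_mul J S (c *: y).
Proof.
by move=> Jc Sy; exists unit, (fun=> c), (fun=> y); split=> //; rewrite sum_unit.
Qed.

Lemma ideal_mul_sub (V : lmodType R) (J : ideal R) (S N : submodule V) :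
  (forall c y, J c -> S y -> N (c *: y)) -> forall z, ideal_mul J S z -> N z.
Proof.
by move=> JSN _ [I [c [y [Jc Sy ->]]]]; apply: smem_sum => i; apply: JSN.
Qed.

Definition linear_combs (V : lmodType R) (I : finType) (a : I -> R)
    (S : submodule V) : submodule V.
Proof.
exists (fun z => exists y : I -> V, (forall i, S (y i)) /\ z = \sum_i a i *: y i).
  exists (fun=> 0); split=> [_|]; first exact: smem0.
  by rewrite big1 // => i _; rewrite scaler0.
move=> b _ _ [y [Sy ->]] [z [Sz ->]]; exists (fun i => b *: y i + z i); split.
  by move=> i; apply: smemL.
rewrite scaler_sumr -big_split; apply: eq_bigr => i _ /=.
by rewrite scalerDr !scalerA mulrC.
Defined.

Lemma fcoef_sum (T : choiceType) (t : T) (I : finType) (c : I -> R)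
    (u : I -> freemod R T) :
  fcoef t (\sum_i c i *: u i) = \sum_i c i * fcoef t (u i).
Proof.
rewrite -[LHS]/(fcoord R t _) linear_sum; apply: eq_bigr => i _.
by rewrite linearZ.
Qed.

Lemma free_decomp (T : choiceType) (u : freemod R T) :
  u = \sum_(t <- msupp u) fcoef t u *: fbasis R t.
Proof. exact: free_sum (fsubset_refl _). Qed.

Lemma free_divide (T : choiceType) (r : R) (u : freemod R T) :
  (forall t, principal r (fcoef t u)) -> exists w, u = r *: w.
Proof.
move=> /choice[c cE]; exists (\sum_(t <- msupp u) c t *: fbasis R t).
rewrite {1}(free_decomp u) scaler_sumr; apply: eq_bigr => t _.
by rewrite cE scalerA mulrC.
Qed.

Lemma flat_in_ext (V : lmodType R) (S S' : V -> Prop) :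
  (forall x, S x <-> S' x) -> flat_in S -> flat_in S'.
Proof.
move=> SS' ?; have -> // : S' = S.
by apply/funext => x; apply/propext; split=> /SS'.
Qed.

Lemma zero_flat (V : lmodType R) (S : submodule V) :
  (forall x, S x -> x = 0) -> flat_in S.
Proof.
move=> S0 I a x Sx _; exists void, (zero_map _ _), (fun=> 0); split=> [w|i|].
- exact: smem0.
- by rewrite linear0 [RHS]S0.
- by rewrite big1 // => i _; rewrite scaler0.
Qed.

Lemma flat_in_sub (V : lmodType R) (S : submodule V) :
  flat_in S -> flat_in (fun _ : submod S => True).
Proof.
move=> fS I a x _ ax.
have [|T [f [u [Sf fu au]]]] :=
    fS I a (fun i => subinj S (x i)) (fun i => subinjP _).
  rewrite -[RHS](linear0 (subinj S)) -ax linear_sum.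
  by apply: eq_bigr => i _; rewrite linearZ.
have [g gE] := corestrict Sf; exists T, g, u; split=> // i.
by apply: subinj_inj; rewrite gE fu.
Qed.

Section Villamayor.
Variables (T : choiceType) (V : lmodType R) (p : {linear freemod R T -> V}).
Hypothesis Vf : flat_in (fun _ : V => True).
Hypothesis ps : surj p.

(** A relation [\sum_i c_i p(e_i) = 0] expressing [p x = 0] lifts to elements [u i]
    of a free module; lifting these further along [p] gives elements [g (u i)]
    with the same images as the [e_i], and [h] subtracts them from the [e_i]. *)
Lemma flat_fix1 x : p x = 0 -> exists2 h : {linear freemod R T -> freemod R T},
  (forall w, p (h w) = 0) & h x = x.
Proof.
move=> px0; have [d [c]] : exists (d : {fset T}) (c : T -> R),
    x = \sum_(t <- d) c t *: fbasis R t.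
  by exists (msupp x), (fun t => fcoef t x); apply: free_decomp.
rewrite big_seq_fsetE /= => xE.
pose a (i : d) := c (val i).
have [//||T' [f [u [_ fu au]]]] :=
    Vf (a := a) (x := fun i : d => p (fbasis R (val i))).
  by rewrite -[RHS]px0 xE linear_sum; apply: eq_bigr => i _; rewrite linearZ.
have [g gE] := free_projective f ps.
have [h hE] := free_lift (fun t : T =>
  if insub t is Some i then fbasis R t - g (u (i : d)) else 0).
exists h.
  apply: (free_ind (S := preim_sub h (ker_sub p))) => t /=; rewrite hE.
  case: insubP => [i _ it|_]; last by rewrite linear0.
  by rewrite linearB gE fu it subrr.
rewrite -[RHS]subr0 -[X in _ - X](linear0 g) -au xE !linear_sum -big_split /=.
by apply: eq_bigr => i _; rewrite [h _]linearZ [g _]linearZ /= hE valK scalerBr.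
Qed.

Lemma flat_fix (s : seq (freemod R T)) : (forall x, x \in s -> p x = 0) ->
  exists2 h : {linear freemod R T -> freemod R T},
    (forall w, p (h w) = 0) & forall x, x \in s -> h x = x.
Proof.
elim: s => [|y s IH] ps0.
  by exists (zero_map _ _) => [w|x]; rewrite ?linear0 ?in_nil.
have [|h hp hs] := IH; first by move=> x xs; apply: ps0; rewrite in_cons xs orbT.
have [|k kp ky] := @flat_fix1 (y - h y).
  by rewrite linearB hp ps0 ?subr0 ?in_cons ?eqxx.
(* m is 1 - (1 - k)(1 - h) *)
pose m : {linear freemod R T -> freemod R T} := h \+ (k \o (idfun \- h)).
have mE x : m x = h x + k (x - h x) by [].
exists m => [w|x]; rewrite mE; first by rewrite [p _]linearD hp kp addr0.
rewrite in_cons => /orP[/eqP->|xs]; first by rewrite ky addrC subrK.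
by rewrite hs // subrr linear0 addr0.
Qed.

(** Relations in [ker (e p)] are mapped by [p] to relations in [ker e], and lifted
    back by projectivity of free modules; what remains is a relation in
    [ker p].  This one lives in the free module itself, and is carried into
    [ker p] by an endomorphism fixing its entries. *)
Lemma kernel_flat (M : lmodType R) (e : {linear V -> M}) :
  flat_in (ker_sub e) -> flat_in (ker_sub (e \o p)).
Proof.
move=> fe I a x ex ax.
have [//||T1 [f1 [u [ef1 f1u au]]]] := fe I a (fun i => p (x i)).
  rewrite -[RHS](linear0 p) -ax linear_sum.
  by apply: eq_bigr => i _; rewrite linearZ.
have [g1 g1E] := free_projective f1 ps.
pose l i := x i - g1 (u i).
have [|h hp hl] := flat_fix (s := codom l).
  by move=> _ /codomP[i ->]; rewrite linearB g1E f1u subrr.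
have [i1 i1E] := free_lift (fun t : T1 => fbasis R (inl t : T1 + T)).
have [i2 i2E] := free_lift (fun t : T => fbasis R (inr t : T1 + T)).
have [f fE] := free_lift (fun t : T1 + T =>
  match t with inl t => g1 (fbasis R t) | inr t => h (fbasis R t) end).
have f1E w : f (i1 w) = g1 w.
  by apply: (free_eq (f := f \o i1)) => t /=; rewrite i1E fE.
have f2E w : f (i2 w) = h w.
  by apply: (free_eq (f := f \o i2)) => t /=; rewrite i2E fE.
exists (T1 + T)%type, f, (fun i => i1 (u i) + i2 (l i)); split=> [||].
- apply: (free_ind (S := preim_sub f (ker_sub (e \o p)))) => -[t|t] /=; rewrite fE.
    by rewrite g1E; apply: ef1.
  by rewrite hp linear0.
- by move=> i; rewrite linearD f1E f2E hl ?codom_f // addrC subrK.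
- have al : \sum_i a i *: l i = 0.
    rewrite (eq_bigr (fun i => a i *: x i - g1 (a i *: u i))) => [|i _].
      by rewrite sumrB ax -linear_sum au linear0 subr0.
    by rewrite /l scalerBr [g1 (_ *: _)]linearZ.
  rewrite (eq_bigr (fun i => i1 (a i *: u i) + i2 (a i *: l i))) => [|i _].
    by rewrite big_split /= -!linear_sum au al !linear0 addr0.
  by rewrite scalerDr [i1 (_ *: _)]linearZ [i2 (_ *: _)]linearZ.
Qed.

End Villamayor.

End Flatness.

(** * Images of flat modules in torsion-free modules *)

Section Image.
Variable R : idomainType.

Definition torsionfree (V : lmodType R) (S : V -> Prop) :=
  forall (r : R) x, S x -> r != 0 -> r *: x = 0 -> x = 0.

Lemma flat_torsionfree (V : lmodType R) (S : V -> Prop) :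
  flat_in S -> torsionfree S.
Proof.
move=> fS r x Sx r0 rx.
have [//||T [f [u [_ fu ru]]]] := fS 'I_1 (fun=> r) (fun=> x).
  by rewrite big_ord1.
rewrite big_ord1 in ru; rewrite -(fu ord0) (_ : u ord0 = 0) ?linear0 //.
apply: free_ext => t; apply: (mulfI r0); rewrite -fcoefZ ru.
by rewrite fcoef0 mulr0.
Qed.

Lemma flat_divide (V : lmodType R) (S : V -> Prop) (r a : R) x y :
  flat_in S -> S x -> S y -> a *: x = r *: y ->
  exists (T : choiceType) (f : {linear freemod R T -> V}) (u : freemod R T),
    [/\ forall w, S (f w), f u = x & forall t, principal r (a * fcoef t u)].
Proof.
move=> fS Sx Sy axy.
have [||T [f [u [Sf fu au]]]] := fS bool (fun b => if b then a else - r)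
    (fun b => if b then x else y).
- by case.
- by rewrite big_bool /= axy scaleNr subrr.
exists T, f, (u true); split=> //; first exact: (fu true).
move=> t; exists (fcoef t (u false)); have := congr1 (fcoef t) au.
rewrite fcoef_sum big_bool /= mulNr fcoef0 => /subr0_eq ->.
by rewrite mulrC.
Qed.

Hypothesis hR : almost_perfect_domain R.

Section Core.
Variables (P P' : lmodType R) (q : {linear P -> P'}).
Hypotheses (Pf : flat_in (fun _ : P => True)) (Kf : flat_in (ker_sub q)).
Hypothesis P't : torsionfree (fun _ : P' => True).

Local Notation K := (ker_sub q).
Local Notation T := (full_sub P).

(** In terms of Tor: the span [S] of [x] modulo [J] embeds in [R/r] as the span of
    [a].  As [P/K] has flat dimension at most one, Tor(S, P/K) embeds in
    Tor(R/r, P/K), which vanishes because [P/K] is torsion-free. *)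
Lemma flat_ideal_mul (J : ideal R) x y r a : r != 0 ->
  (forall b, J (b * x) <-> principal r (b * a)) ->
  K y -> ideal_mul J T (x *: y) -> ideal_mul J K (x *: y).
Proof.
move=> r0 xa Ky [I [j [p [Jj _ xy]]]].
have [//||T1 [f [u [_ fu xu]]]] := Pf (I := (unit + I)%type)
  (a := fun i => match i with inl _ => x | inr k => - j k end)
  (x := fun i => match i with inl _ => y | inr k => p k end).
  rewrite big_sumType sum_unit /= xy -big_split big1 //= => i _.
  by rewrite scaleNr subrr.
have Jxu t : J (fcoef t (u (inl tt)) * x).
  have := congr1 (fcoef t) xu; rewrite fcoef_sum big_sumType fcoef0 /=.
  rewrite sum_unit => /eqP; rewrite addr_eq0 mulrC => /eqP ->.
  by apply/smemN/smem_sum => k; rewrite mulNr mulrC; apply/smemN/idealMl.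
(* flatness of P puts y in pP, where p annihilates x modulo J *)
have [w wE] : exists w, a *: u (inl tt) = r *: w.
  by apply: free_divide => t; rewrite fcoefZ mulrC; apply/xa.
have ay : a *: y = r *: f w.
  by rewrite -[y in LHS](fu (inl tt)) -[LHS]linearZ /= wE [LHS]linearZ.
have Kw : K (f w).
  apply: (P't Logic.I r0); rewrite -[LHS]linearZ /= -ay [LHS]linearZ /=.
  by rewrite [q y]Ky scaler0.
have [T2 [g [v [Kg gv rv]]]] := flat_divide Kf Ky Kw ay.
rewrite -gv -[x *: _](linearZ_LR g) (free_decomp (x *: v)) linear_sum.
apply: smem_sum => t; rewrite (linearZ_LR g); apply: ideal_mul_gen; last exact: Kg.
by rewrite fcoefZ mulrC; apply/xa; rewrite mulrC.
Qed.

Lemma ideal_mul_mono (V : lmodType R) (J J' : ideal R) (S S' : submodule V) :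
  (forall x, J x -> J' x) -> (forall y, S y -> S' y) ->
  forall z, ideal_mul J S z -> ideal_mul J' S' z.
Proof.
move=> JJ SS z [I [c [y [Jc Sy ->]]]].
by exists I, c, y; split=> // i; [apply: JJ | apply: SS].
Qed.

(** Take for [I0] the ideal of some elements [a i] and for [X], [Y] the sets of
    combinations of the [a i] over [P] and over [K]: the conclusion is then
    Tor(R/I0, P/K) = 0.  Zorn's lemma gives a maximal ideal [J] above [I0] for
    which [J K] and [X] meet inside [Y], and [flat_ideal_mul] shows that a simple
    submodule of [R/J] could still be added. *)
Lemma image_flat_core (X Y : submodule P) (I0 : ideal R) c0 :
  I0 c0 -> c0 != 0 -> (forall c y, I0 c -> K y -> Y (c *: y)) ->
  (forall z, X z -> ideal_mul I0 T z) -> forall z, K z -> X z -> Y z.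
Proof.
move=> Ic c0n IKY XIP.
pose Q (A : set R^o) := exists J : ideal R,
  [/\ A = J :> set R^o, (I0 : set R^o) `<=` J
    & forall z, ideal_mul J K z -> X z -> Y z].
have QI0 : Q I0 by exists I0; split=> // z Iz _; apply: ideal_mul_sub Iz.
have [F [A0 FA0] FQ Ftot|_ [[J [-> IJ JKY]] _ Jmax]] := zorn_above QI0.
  pose U : set R^o := \bigcup_(A in F) A.
  have [J0 [A0E IJ0 _]] := FQ _ FA0.
  have U0 : U 0 by exists A0 => //; rewrite A0E; apply: smem0.
  have UL a x y : U x -> U y -> U (a *: x + y).
    move=> [A FA Ax] [B FB By].
    have [D FD [Dx Dy]] : exists2 D, F D & D x /\ D y.
      by case: (Ftot A B FA FB) => AB; [exists B | exists A] => //;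
        split=> //; apply: AB.
    have [J [DJ _ _]] := FQ _ FD; exists D => //.
    by rewrite DJ; apply: smemL; rewrite -DJ.
  have N0 : exists J : ideal R, F J /\ ideal_mul J K 0.
    by exists J0; split; [rewrite -A0E | apply: smem0].
  have NL a x y : (exists J : ideal R, F J /\ ideal_mul J K x) ->
      (exists J : ideal R, F J /\ ideal_mul J K y) ->
      exists J : ideal R, F J /\ ideal_mul J K (a *: x + y).
    move=> [J [FJ Jx]] [J' [FJ' Jy]]; case: (Ftot J J' FJ FJ') => JJ.
      by exists J'; split=> //; apply: smemL => //; apply: ideal_mul_mono Jx.
    by exists J; split=> //; apply: smemL => //; apply: ideal_mul_mono Jy.
  exists (Submodule U0 UL); split=> // [x Ix|z].
    by exists A0; rewrite // A0E; apply: IJ0.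
  move=> /(ideal_mul_sub (N := Submodule N0 NL))[c y [A FA Ac] Ky|J [FJ Jz] Xz].
    have [J [AJ _ _]] := FQ _ FA; exists J; rewrite -AJ; split=> //.
    by apply: ideal_mul_gen => //; rewrite -AJ.
  have [J' [JJ' _ JKY]] := FQ _ FJ; apply: JKY Xz; apply: ideal_mul_mono Jz => // x.
  by rewrite JJ'.
have J1 : J 1.
  apply: contrapT => J1.
  have [x [r [a [nJx r0 xa]]]] := common_simple hR (IJ _ Ic) c0n J1.
  apply: nJx; apply: (Jmax (adjoin J x)) (adjoin_mem _ _); first exact: adjoin_sub.
  exists (adjoin J x); split=> // [y Iy|z Jz Xz]; first exact/adjoin_sub/IJ.
  apply: JKY => //.
  have [y [Ky Jzy]] : exists y, K y /\ ideal_mul J K (z - x *: y).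
    have N0 : exists y, K y /\ ideal_mul J K (0 - x *: y).
      by exists 0; rewrite scaler0 subr0; split; apply: smem0.
    have NL b u v : (exists y, K y /\ ideal_mul J K (u - x *: y)) ->
        (exists y, K y /\ ideal_mul J K (v - x *: y)) ->
        exists y, K y /\ ideal_mul J K (b *: u + v - x *: y).
      move=> [y [Ky Ju]] [y' [Ky' Jv]]; exists (b *: y + y').
      split; first exact: smemL.
      have -> : b *: u + v - x *: (b *: y + y') = b *: (u - x *: y) + (v - x *: y').
        by rewrite scalerBr scalerDr opprD addrACA !scalerA mulrC.
      exact: smemL.
    apply: (ideal_mul_sub (N := Submodule N0 NL)) Jz => c y [b Jb] Ky.
    exists (b *: y); split; first exact: smemZ.
    by rewrite scalerA mulrC -scalerBl; apply: ideal_mul_gen.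
  rewrite -[z](subrK (x *: y)); apply: smemD => //.
  apply: (flat_ideal_mul r0 xa Ky); rewrite -[x *: y](subKr z).
  apply: smemB; first by apply: ideal_mul_mono (XIP _ Xz).
  exact: ideal_mul_mono Jzy.
by move=> z Kz; apply: JKY; rewrite -[z]scale1r; apply: ideal_mul_gen.
Qed.

(** A relation [\sum_i a_i q(p_i) = 0] says that [\sum_i a_i p_i] lies in [K].
    By [image_flat_core] it equals [\sum_i a_i y_i] with [y_i] in [K], so
    replacing [p_i] by [p_i - y_i] lifts the relation to the flat module [P]. *)
Lemma image_flat : flat_in (im_sub q).
Proof.
move=> I a x /choice[p pE] ax.
have [a0|/existsNP[i0 /eqP ai0]] := pselect (forall i, a i = 0).
  have [f fE] := free_lift x; exists I, f, (@fbasis R I).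
  split=> // [|]; last first.
    by rewrite big1 // => i _; rewrite a0 scale0r.
  by apply: (free_ind (S := preim_sub f (im_sub q))) => i; exists (p i); rewrite fE.
pose I0 : ideal R := linear_combs a (full_sub (R^o : lmodType R)).
have Ia i : I0 (a i).
  exists (fun j => (j == i)%:R); split=> //.
  rewrite (bigD1 i) //= big1 => [|j /negPf ->]; last by rewrite scaler0.
  by rewrite eqxx addr0 /GRing.scale /= mulr1.
have [||||y [Ky ey]] :=
  @image_flat_core (linear_combs a T) (linear_combs a K) I0 (a i0) (Ia i0) ai0 _ _
    (\sum_i a i *: p i) _ _.
- move=> c y [b [_ ->]] Ky; exists (fun i => b i *: y).
  split=> [i|]; first exact: smemZ.
  by rewrite scaler_suml; apply: eq_bigr => i _; rewrite scalerA.
- by move=> _ [y [_ ->]]; apply: smem_sum => i; apply: ideal_mul_gen.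
- rewrite /= linear_sum -[RHS]ax; apply: eq_bigr => i _.
  by rewrite (linearZ_LR q) pE.
- by exists p.
have [//||T1 [f [u [_ fu au]]]] := Pf (a := a) (x := fun i => p i - y i).
  rewrite -[RHS](subrr (\sum_i a i *: y i)) -{1}ey -sumrB.
  by apply: eq_bigr => i _; rewrite scalerBr.
exists T1, (q \o f), u; split=> // [w|i] /=; first by exists (f w).
by rewrite fu linearB pE [q (y i)]Ky subr0.
Qed.

End Core.
End Image.

(** * Flat submodules of free modules are projective *)

Lemma free_cover (R : comNzRingType) (V : lmodType R) :
  exists2 p : {linear freemod R V -> V}, forall x, p (fbasis R x) = x & surj p.
Proof.
by have [p pE] := free_lift (fun x : V => x); exists p => // x; exists (fbasis R x).
Qed.

(** The ring morphism is an explicit parameter of the type, since it determines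
    the scalar action. *)
Definition restriction (R A : comNzRingType) (pi : {rmorphism R -> A})
  (V : lmodType A) : Type := V.

Section Restriction.
Variables (R A : comNzRingType) (pi : {rmorphism R -> A}).
Local Notation restr := (restriction pi).

HB.instance Definition _ V := GRing.Zmodule.on (restr V).

Definition restriction_scale (V : lmodType A) (a : R) (x : restr V) : restr V :=
  pi a *: (x : V).

Lemma restriction_scaleA (V : lmodType A) a b (x : restr V) :
  restriction_scale a (restriction_scale b x) = restriction_scale (a * b) x.
Proof. by rewrite /restriction_scale scalerA rmorphM. Qed.

Lemma restriction_scale1 (V : lmodType A) : left_id 1 (@restriction_scale V).
Proof. by move=> x; rewrite /restriction_scale rmorph1 scale1r. Qed.

Lemma restriction_scaleDr (V : lmodType A) :
  right_distributive (@restriction_scale V) +%R.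
Proof. by move=> a x y; rewrite /restriction_scale scalerDr. Qed.

Lemma restriction_scaleDl (V : lmodType A) (x : restr V) :
  {morph (@restriction_scale V)^~ x : a b / a + b}.
Proof. by move=> a b; rewrite /restriction_scale rmorphD scalerDl. Qed.

HB.instance Definition _ V := GRing.Zmodule_isLmodule.Build R (restr V)
  (@restriction_scaleA V) (@restriction_scale1 V)
  (@restriction_scaleDr V) (@restriction_scaleDl V).

Lemma restriction_scaleE (V : lmodType A) a (x : restr V) :
  a *: x = pi a *: (x : V) :> V.
Proof. by []. Qed.

Lemma free_base_change (T : choiceType) :
  exists2 red : {linear freemod R T -> restr (freemod A T)},
    forall t, red (fbasis R t) = fbasis A t &
    forall x t, fcoef t (red x : freemod A T) = pi (fcoef t x).
Proof.
have [red redE] := free_lift (fun t : T => fbasis A t : restr (freemod A T)).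
exists red => // x t; rewrite (free_decomp x) linear_sum.
rewrite -[LHS]/(fcoord A t _) -[X in pi X]/(fcoord R t _).
rewrite !linear_sum rmorph_sum; apply: eq_bigr => u _ /=.
rewrite linearZ /= redE restriction_scaleE !fcoefZ rmorphM !fcoef_basis.
by rewrite rmorph_nat.
Qed.

End Restriction.

Section DivisibleTarget.
Variable R : idomainType.
Hypothesis hR : almost_perfect_domain R.

(** Present [U] by a free module [F] with kernel [L].  A lift [g] of [f] along
    multiplication by [r] is killed by [r] on [L], hence factors there through
    the reduction of [L] modulo [r].  The quotient of the reductions is flat
    over the perfect ring [R/r], so there is a retraction [rho] onto the
    reduction of [L], through which [g] on [L] extends to a map [h] on [F] with
    [r h = 0]; then [g - h] induces the quotient of [f] by [r]. *)
Lemma flat_hom_divide (U D : lmodType R) (r : R) (f : {linear U -> D}) :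
  flat_in (fun _ : U => True) -> divisible D -> r != 0 ->
  exists f' : {linear U -> D}, forall x, r *: f' x = f x.
Proof.
move=> Uf dD r0; have [[c c1]|r1] := pselect (principal r 1).
  exists (c \*: f) => x /=.
  by rewrite scalerA mulrC -c1 scale1r.
have [A pA [pi pis piE]] := perfect_quotient hR r1 (principal_id r) r0.
have [p pb ps] := free_cover U.
have [red redb redE] := free_base_change pi U.
have redL a x y :
    red (a *: x + y) = pi a *: (red x : freemod A U) + red y :> freemod A U.
  exact: linearP.
have red_eq0 x : red x = 0 -> exists w, x = r *: w.
  by move=> rx; apply: free_divide => t; apply/piE; rewrite -redE rx fcoef0.
have LA0 : exists2 x, p x = 0 & red x = (0 : freemod A U).
  by exists 0; rewrite ?linear0.
have LAL (a : A) (y z : freemod A U) :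
    (exists2 x, p x = 0 & red x = y) -> (exists2 x, p x = 0 & red x = z) ->
    exists2 x, p x = 0 & red x = a *: y + z.
  have [b <-] := pis a; move=> [x px <-] [w pw <-]; exists (b *: x + w) => //.
  by rewrite linearP px pw scaler0 addr0.
pose LA : submodule (freemod A U) := Submodule LA0 LAL.
have [rho rhoL rho_id] : exists2 rho : {linear freemod A U -> freemod A U},
    (forall y, LA (rho y)) & forall y, LA y -> rho y = y.
  apply: (perfect_retract (L := LA) pA (@free_projective A U)) => y [x px xy].
  have [h hp hx] := flat_fix1 Uf ps px.
  have [k kE] := free_lift (fun t : U => red (h (fbasis R t)) : freemod A U).
  have kred w : k (red w) = red (h w).
    have K0 : k (red 0) = red (h 0) by rewrite !linear0.
    have KL a u v : k (red u) = red (h u) -> k (red v) = red (h v) ->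
        k (red (a *: u + v)) = red (h (a *: u + v)).
      by move=> ku kv; rewrite redL [k _]linearP ku kv [h (_ + _)]linearP redL.
    apply: (free_ind (S := Submodule K0 KL)) => t /=.
    by rewrite redb kE.
  exists k; last by rewrite -xy kred hx.
  apply: (free_ind (S := preim_sub k LA)) => t /=; rewrite kE.
  by exists (h (fbasis R t)).
have /choice[d dE] : forall t : U, exists d, r *: d = f t by move=> t; apply: dD.
have [g gb] := free_lift d.
(* p : F -> U is the free cover, with kernel L, and red : F -> F/rF *)
have gE x : r *: g x = f (p x).
  by apply: (free_eq (f := r \*: g) (g := f \o p)) => t /=; rewrite gb dE pb.
have g0 x : p x = 0 -> red x = 0 -> g x = 0.
  move=> px /red_eq0[w xw]; rewrite xw linearZ /= gE.
  rewrite (flat_torsionfree Uf _ r0 (x := p w)) ?linear0 //.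
  by rewrite -(linearZ_LR p) -xw.
have g_eq x y : p x = 0 -> p y = 0 -> red x = red y -> g x = g y.
  move=> px py xy; apply/subr0_eq; rewrite -linearB; apply: g0.
    by rewrite linearB px py subrr.
  rewrite -scaleN1r addrC redL xy rmorphN1 scaleN1r addrC; exact: subrr.
have /choice[l lE] : forall x, exists y, p y = 0 /\ red y = rho (red x).
  by move=> x; have [y py yx] := rhoL (red x); exists y.
have hL : linear (g \o l).
  move=> a x y /=; rewrite -linearP; apply: g_eq; first exact: (lE _).1.
    by rewrite linearP !(lE _).1 scaler0 addr0.
  by rewrite redL !(lE _).2 redL linearP.
have [|f' f'E] := factor_surj (f := g \- mklin hL) ps.
  move=> x px; rewrite /= (g_eq (l x) x) ?subrr //; first exact: (lE _).1.
  by rewrite (lE _).2 rho_id //; exists x.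
exists f' => x; have [y <-] := ps x.
by rewrite f'E /= scalerBr !gE (lE _).1 linear0 subr0.
Qed.

Section Extend.
Variables (W D : lmodType R).
Hypotheses (dW : divisible W) (tW : torsionfree (fun _ : W => True)).
Hypothesis dD : divisible D.

Lemma flat_chain (F : set (set W)) : F !=set0 ->
  F `<=` (fun X => flat_in X) -> total_on F subset ->
  flat_in (\bigcup_(X in F) X).
Proof.
move=> [X0 FX0] Ff Ftot I a x Fx ax.
have [X FX Xx] : exists2 X, F X & forall i, i \in enum I -> X (x i).
  elim: (enum I) => [|j s [X FX Xs]]; first by exists X0.
  have [Y FY Yj] := Fx j.
  case: (Ftot X Y FX FY) => XY; [exists Y | exists X] => // i;
    rewrite in_cons => /orP[/eqP->|/Xs] //; exact: XY.
have [|//|T [f [u [Xf fu au]]]] := Ff X FX I a x.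
  by move=> i; apply: Xx; rewrite mem_enum.
by exists T, f, u; split=> // w; exists X.
Qed.

Definition scale_lin (r : R) : {linear W -> W} := r \*: idfun.

(** Multiplication by [r] is an isomorphism from this submodule to [U]. *)
Lemma flat_preim_scale (r : R) (U : submodule W) : r != 0 ->
  flat_in U -> flat_in (preim_sub (scale_lin r) U).
Proof.
move=> r0 fU I a x Ux ax.
have [||T [f [u [Uf fu au]]]] := fU I a (fun i => r *: x i); first exact: Ux.
  transitivity (r *: \sum_i a i *: x i); last by rewrite ax scaler0.
  rewrite scaler_sumr; apply: eq_bigr => i _.
  by rewrite !scalerA mulrC.
have /choice[d dE] : forall t, exists d : W, r *: d = f (fbasis R t).
  by move=> t; apply: dW.
have [g gE] := free_lift d.
have rg w : r *: g w = f w.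
  by apply: (free_eq (f := r \*: g)) => t /=; rewrite gE dE.
exists T, g, u; split=> // [w|i]; first by rewrite /= rg.
apply/subr0_eq; apply: (tW _ r0) => //.
by rewrite scalerBr rg fu subrr.
Qed.

Lemma flat_adjoin (U : submodule W) x : flat_in U ->
  (forall b, U (b *: x) -> b = 0) -> flat_in (adjoin U x).
Proof.
move=> fU Ux I a y /choice[b Ub] ay.
have e : \sum_i a i *: (y i - b i *: x) = - (\sum_i a i * b i) *: x.
  rewrite scaleNr scaler_suml -[RHS]add0r -[X in X - _]ay -sumrB.
  by apply: eq_bigr => i _; rewrite scalerBr scalerA.
have /Ux ab : U ((\sum_i a i * b i) *: x).
  rewrite -[_ *: x]opprK -scaleNr -e; apply/smemN/smem_sum => i.
  exact: smemZ.
have [//||T [f [v [Uf fv av]]]] := fU I a (fun i => y i - b i *: x).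
  by rewrite e ab oppr0 scale0r.
have [j jE] := free_lift (fun t : T => fbasis R (inr t : unit + T)).
have [g gE] := free_lift (fun t : unit + T =>
  match t with inl _ => x | inr t => f (fbasis R t) end).
have gj w : g (j w) = f w by apply: (free_eq (f := g \o j)) => t /=; rewrite jE gE.
exists (unit + T)%type, g, (fun i => b i *: fbasis R (inl tt) + j (v i)); split.
- apply: (free_ind (S := preim_sub g (adjoin U x))) => -[[]|t]; rewrite /= gE.
    exact: adjoin_mem.
  exact/adjoin_sub.
- by move=> i; rewrite linearD linearZ /= gE gj fv addrC subrK.
- rewrite (eq_bigr (fun i => (a i * b i) *: fbasis R (inl tt) + j (a i *: v i))).
    by rewrite big_split /= -scaler_suml -linear_sum ab av scale0r linear0 addr0.
  by move=> i _; rewrite scalerDr scalerA linearZ.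
Qed.

(** If [r w] is in [U] for some [w] outside [U], extend to all such [w] by means
    of a quotient of [f] by [r].  If there is none, the sum of [U] and [R x] is
    direct. *)
Lemma flat_hom_step (U : submodule W) (f : W -> D) x :
    flat_in U -> linear_on U f -> ~ U x ->
  exists (V : submodule W) g, [/\ (U : set W) `<=` V, exists2 y, V y & ~ U y,
    flat_in V, linear_on V g & forall y, U y -> g y = f y].
Proof.
move=> fU fL nUx.
have [[r [w [r0 Urw nUw]]]|nr] :=
  pselect (exists r w, [/\ r != 0, U (r *: w) & ~ U w]).
  have [f1 f1E] := linear_on_sub fL.
  have [f2 f2E] := flat_hom_divide f1 (flat_in_sub fU) dD r0.
  have /choice[g gE] : forall y, exists d,
      forall u, subinj U u = r *: y -> d = f2 u.
    move=> y; have [/subinj_surj[u uy]|nU] := pselect (U (r *: y)).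
      by exists (f2 u) => v vy; congr (f2 _); apply: subinj_inj; rewrite uy vy.
    by exists 0 => u uy; case: nU; rewrite -uy; apply: subinjP.
  exists (preim_sub (scale_lin r) U), g; split.
  - by move=> y Uy; apply: smemZ.
  - by exists w.
  - exact: flat_preim_scale.
  - move=> a y z /= /subinj_surj[u uy] /subinj_surj[v vz].
    rewrite (gE y u uy) (gE z v vz) -linearP; apply: gE.
    by rewrite linearP uy vz scalerDr !scalerA mulrC.
  - move=> y /subinj_surj[u uy]; rewrite (gE y (r *: u)).
      by rewrite (linearZ_LR f2) f2E f1E uy.
    by rewrite linearZ uy.
have Ux b : U (b *: x) -> b = 0.
  by move=> Ub; apply/eqP/negP => /negP b0; apply: nr; exists b, x.
have [|g [gL gE _]] := adjoin_hom (x := x) (c := 0) fL.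
  by move=> b /Ux ->; rewrite !scale0r (linear_on0 fL).
exists (adjoin U x), g; split=> //; first exact: adjoin_sub.
  by exists x => //; apply: adjoin_mem.
exact: flat_adjoin.
Qed.

Lemma flat_hom_extend (U : submodule W) (f : W -> D) : flat_in U -> linear_on U f ->
  exists h : {linear W -> D}, forall x, U x -> h x = f x.
Proof.
move=> fU fL; apply: (hom_extension (Pd := fun X => flat_in X)) => //.
- by move=> F F0 FP Ftot; apply: flat_chain.
- by move=> V g x fV gL; apply: flat_hom_step.
Qed.

End Extend.

Lemma tofrac_neq0 (r : R) : r != 0 -> FracField.tofrac r != 0.
Proof. by rewrite tofrac_eq0. Qed.

Section Hull.
Variable V : lmodType {fraction R}.
Local Notation W := (restriction (@FracField.tofrac R) V).

Lemma restriction_divisible : divisible W.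
Proof.
move=> r r0 x; exists ((FracField.tofrac r)^-1 *: (x : V)).
by rewrite restriction_scaleE scalerA divff ?tofrac_neq0 ?scale1r.
Qed.

Lemma restriction_torsionfree : torsionfree (fun _ : W => True).
Proof.
move=> r x _ r0; rewrite restriction_scaleE => /eqP.
by rewrite scaler_eq0 (negPf (tofrac_neq0 r0)) => /eqP.
Qed.
End Hull.

Definition image_of (U V : lmodType R) (j : {linear U -> V}) (K : submodule U) :
    submodule V :=
  im_sub (j \o subinj K).

Lemma image_ofP (U V : lmodType R) (j : {linear U -> V}) (K : submodule U) y :
  image_of j K y <-> exists2 x, K x & j x = y.
Proof.
split=> [[x <-]|[x /subinj_surj[z <-] <-]]; last by exists z.
by exists (subinj K x) => //; apply: subinjP.
Qed.

Lemma flat_map (U V : lmodType R) (j : {linear U -> V}) (K : submodule U) :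
  injective j -> flat_in K -> flat_in (image_of j K).
Proof.
move=> ij fK I a x /choice[y yx] ay.
have [||T [f [u [Kf fu au]]]] := fK I a (fun i => subinj K (y i)).
- by move=> i; apply: subinjP.
- apply: ij; rewrite linear0 -[RHS]ay linear_sum; apply: eq_bigr => i _.
  by rewrite linearZ -yx.
exists T, (j \o f), u; split=> // [w|i]; first by apply/image_ofP; exists (f w).
by rewrite /= fu -yx.
Qed.

(** The hull is the vector space with the same basis over the field of
    fractions. *)
Lemma free_hull (T : choiceType) :
  exists (W : lmodType R) (j : {linear freemod R T -> W}),
  [/\ injective j, divisible W & torsionfree (fun _ : W => True)].
Proof.
have [j _ jE] := free_base_change (@FracField.tofrac R) T.
exists (restriction (@FracField.tofrac R) (freemod {fraction R} T)), j; split.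
- move=> x y xy; apply: free_ext => t; apply/eqP; rewrite -tofrac_eq.
  by rewrite -!jE xy.
- exact: restriction_divisible.
- exact: restriction_torsionfree.
Qed.

Lemma flat_sub_free_hom_extend (T : choiceType) (K : submodule (freemod R T))
    (D : lmodType R) (f : {linear submod K -> D}) :
  flat_in K -> divisible D ->
  exists g : {linear freemod R T -> D}, forall x, g (subinj K x) = f x.
Proof.
move=> fK dD; have [W [j [ij dW tW]]] := free_hull T.
have /choice[f0 f0E] : forall y, exists d, forall x, j (subinj K x) = y -> d = f x.
  move=> y; have [[x <-]|ny] := pselect (exists x, j (subinj K x) = y).
    by exists (f x) => z /ij/(@subinj_inj _ _ K) ->.
  by exists 0 => x jx; case: ny; exists x.
have [|h hE] := flat_hom_extend (f := f0) dW tW dD (flat_map ij fK).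
  move=> a _ _ [x <-] [y <-]; by rewrite -linearP !(f0E _ _ erefl) linearP.
by exists (h \o j) => x /=; rewrite hE; [apply: f0E | exists x].
Qed.

(** Let [p] be a free cover of [A], with divisible hull [W], and let [N] be the
    kernel of [q p], so that [B] embeds in [W/N] by [k].  The composite of [h]
    and [k] extends to the free module and lifts to a map [u] into [W].  On
    [K] the class of [u] modulo [N] comes from [B], so [u] takes its values in
    the free cover itself. *)
Lemma flat_sub_free_projective (T : choiceType) (K : submodule (freemod R T)) :
  flat_in K -> projective (submod K).
Proof.
move=> fK A B q h qs.
have [p pb ps] := free_cover A.
have [W [j [ij dW _]]] := free_hull A.
have qps : surj (q \o p).
  by move=> b; have [a <-] := qs b; have [x <-] := ps a; exists x.
pose N := image_of j (ker_sub (q \o p)).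
have [|k kE] := factor_surj (f := quotpi N \o j) qps.
  by move=> x qpx; apply/quotpi_eq0/image_ofP; exists x.
have kI : injective k.
  move=> b b' kb; apply/subr0_eq; have [x xb] := qps (b - b').
  have : k (b - b') = 0 by rewrite linearB kb subrr.
  rewrite -xb kE => /quotpi_eq0/image_ofP[y yk /ij <-].
  exact: yk.
have dD := divisible_surj dW (@quotpi_surj _ _ N).
have [g gE] := flat_sub_free_hom_extend (k \o h) fK dD.
have [u uE] := free_projective g (@quotpi_surj _ _ N).
have [|v vE] := factor_inj (f := u \o subinj K) ij.
  move=> x; have [y yx] := qps (h x).
  have /quotpi_eq/image_ofP[z _ zE] : quotpi N (u (subinj K x)) = quotpi N (j y).
    by rewrite uE gE /= -yx kE.
  by exists (z + y); rewrite linearD zE subrK.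
exists (p \o v) => x; apply: kI.
have vxE : j (v x) = u (subinj K x) := vE x.
have kvE : k (q (p (v x))) = quotpi N (j (v x)) := kE (v x).
by rewrite [LHS]kvE vxE uE gE.
Qed.

End DivisibleTarget.

(** * Comparison with flatness for the tensor product *)

Section TensorFlat.
Variable R : comNzRingType.

Lemma tensor_lin (M N P : lmodType R) (b : M -> N -> P) :
  (forall n, linear (b^~ n)) -> (forall m, linear (b m)) ->
  exists2 f : {linear tensor M N -> P},
    forall m n, f (pure_tensor m n) = b m n &
    forall u, f u = \sum_(x <- repr u) b x.1 x.2.
Proof.
move=> bl br; exists (mklin (tensor_lift_linear bl br)) => // m n.
exact: tensor_lift_pure.
Qed.

Section Syzygy.
Variables (M : lmodType R) (I : finType) (a : I -> R).

(** Families in [M] along which the relation with coefficients [a] lifts to a free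
    module.  They form a submodule, which serves as the target of a bilinear
    map below: the quotient by it detects non-liftable relations. *)
Definition trivial_syzygy (v : {ffun I -> M}) := exists (T : choiceType)
  (f : {linear freemod R T -> M}) (u : I -> freemod R T),
  (forall i, f (u i) = v i) /\ \sum_i a i *: u i = 0.

Lemma trivial_syzygy0 : trivial_syzygy 0.
Proof.
exists void, (zero_map _ _), (fun=> 0).
split=> [i|]; first by rewrite linear0 ffunE.
by rewrite big1 // => i _; rewrite scaler0.
Qed.

Lemma trivial_syzygyL c v w :
  trivial_syzygy v -> trivial_syzygy w -> trivial_syzygy (c *: v + w).
Proof.
move=> [T1 [f1 [u1 [fu1 au1]]]] [T2 [f2 [u2 [fu2 au2]]]].
have [i1 i1E] := free_lift (fun t : T1 => fbasis R (inl t : T1 + T2)).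
have [i2 i2E] := free_lift (fun t : T2 => fbasis R (inr t : T1 + T2)).
have [f fE] := free_lift (fun t : T1 + T2 =>
  match t with inl t => f1 (fbasis R t) | inr t => f2 (fbasis R t) end).
have fi1 w' : f (i1 w') = f1 w'.
  by apply: (free_eq (f := f \o i1)) => t /=; rewrite i1E fE.
have fi2 w' : f (i2 w') = f2 w'.
  by apply: (free_eq (f := f \o i2)) => t /=; rewrite i2E fE.
exists (T1 + T2)%type, f, (fun i => c *: i1 (u1 i) + i2 (u2 i)); split=> [i|].
  by rewrite !ffunE linearP fi1 fi2 fu1 fu2.
rewrite (eq_bigr (fun i => c *: i1 (a i *: u1 i) + i2 (a i *: u2 i))) => [|i _].
  rewrite big_split /= -scaler_sumr -(linear_sum i1) -(linear_sum i2).
  by rewrite au1 au2 !linear0 addr0.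
by rewrite scalerDr [i1 (_ *: _)]linearZ [i2 (_ *: _)]linearZ !scalerA mulrC.
Qed.

Definition trivial_syzygies : submodule {ffun I -> M} :=
  Submodule trivial_syzygy0 trivial_syzygyL.

Lemma trivial_syzygy_ker (k : I -> R) (y : M) : \sum_i a i * k i = 0 ->
  trivial_syzygies [ffun i => k i *: y].
Proof.
move=> ak; have [f fE] := free_lift (fun _ : unit => y).
exists unit, f, (fun i => k i *: fbasis R tt); split=> [i|].
  by rewrite ffunE linearZ /= fE.
rewrite (eq_bigr (fun i => (a i * k i) *: fbasis R tt)) => [|i _].
  by rewrite -scaler_suml ak scale0r.
by rewrite scalerA.
Qed.

End Syzygy.

(** Let [J] be the ideal of the [a i].  The relation says that the tensor
    [\sum_i x_i (x) a_i] vanishes over [R], so by flatness it vanishes in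
    M (x) J.  Writing elements of [J] as combinations of the [a i] is ambiguous up
    to relations between the [a i], and these produce liftable families; so
    M (x) J maps to the quotient by [trivial_syzygies], with [x] as the image of
    that tensor. *)
Lemma flat_flat_in (M : lmodType R) : flat M -> flat_in (fun _ : M => True).
Proof.
move=> Mf I a x _ ax.
pose S := trivial_syzygies M a.
suff [T [f [u [fu au]]]] : S (finfun x).
  by exists T, f, u; split=> // i; rewrite fu ffunE.
have [phi phiE] := free_lift (a : I -> R^o).
have phi_sum k : phi k = \sum_i a i * fcoef i k.
  have L : linear (fun k : freemod R I => \sum_i a i * fcoef i k : R^o).
    move=> r u v; rewrite scaler_sumr -big_split; apply: eq_bigr => i _ /=.
    by rewrite fcoefD fcoefZ mulrDr mulrCA.
  apply: (free_eq (g := mklin L)) => i; rewrite phiE mklinE (bigD1 i) //=.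
  rewrite fcoef_basis eqxx mulr1 big1 ?addr0 // => j ji.
  by rewrite fcoef_basis eq_sym (negPf ji) mulr0.
pose J := submod (im_sub phi).
have /choice[c cE] : forall z : J, exists k, phi k = subinj _ z.
  by move=> z; apply: (subinjP z).
have /choice[al alE] : forall i, exists z : J, subinj _ z = a i.
  by move=> i; apply: subinj_surj; exists (fbasis R i).
pose b (m : M) (z : J) := quotpi S [ffun i => fcoef i (c z) *: m].
have b_eq m k k' : phi k = phi k' ->
    quotpi S [ffun i => fcoef i k *: m] = quotpi S [ffun i => fcoef i k' *: m].
  move=> kk; apply/quotpi_eq.
  have -> : [ffun i => fcoef i k *: m] - [ffun i => fcoef i k' *: m]
      = [ffun i => fcoef i (k - k') *: m].
    by apply/ffunP => i; rewrite !ffunE -scalerBl -scaleN1r fcoefD fcoefZ mulN1r.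
  by apply: trivial_syzygy_ker; rewrite -phi_sum linearB kk subrr.
have bl z : linear (b^~ z).
  move=> r m m'; rewrite /b -linearP; congr (quotpi S _).
  by apply/ffunP => i; rewrite !ffunE scalerDr !scalerA mulrC.
have br m : linear (b m).
  move=> r z z'; rewrite /b -linearP.
  rewrite (b_eq m (c _) (r *: c z + c z')); last by rewrite cE !linearP !cE.
  congr (quotpi S _); apply/ffunP => i.
  by rewrite !ffunE fcoefD fcoefZ scalerDl scalerA.
have [B BE _] := tensor_lin bl br.
pose xi := \sum_i pure_tensor (x i) (al i).
have xi0 : xi = 0.
  apply: (Mf J (R^o) (subinj _) (@subinj_inj _ _ (im_sub phi))).
  have tE := mklinE
    (tensor_map_linear (idfun : {linear M -> M}) (subinj (im_sub phi))).
  rewrite -!tE linear0 linear_sum.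
  rewrite -[RHS](linear0 (mklin (pure_tensor_linearl (1 : R^o)))) -ax.
  rewrite linear_sum; apply: eq_bigr => i _; rewrite !mklinE tensor_map_pure alE.
  apply/esym/tensor_classP; rewrite -[a i in X in tensor_rel _ X]mulr1.
  exact: TensorZ.
apply/quotpi_eq0; rewrite -(linear0 B) -xi0 linear_sum.
rewrite [RHS](eq_bigr (fun i => quotpi S [ffun j => fcoef j (fbasis R i) *: x i])).
  rewrite -linear_sum; congr (quotpi S _); apply/ffunP => i.
  rewrite ffunE sum_ffunE.
  rewrite (bigD1 i) //= ffunE fcoef_basis eqxx scale1r big1 ?addr0 // => j ji.
  by rewrite ffunE fcoef_basis (negPf ji) scale0r.
by move=> i _; rewrite BE; apply: b_eq; rewrite cE alE phiE.
Qed.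

Lemma msupp_bound (T : choiceType) (X : eqType) (g : X -> freemod R T) (l : seq X) :
  exists d : {fset T}, forall x, x \in l -> (msupp (g x) `<=` d)%fset.
Proof.
elim: l => [|y l [d dl]]; first by exists fset0.
exists (msupp (g y) `|` d)%fset => x; rewrite in_cons => /orP[/eqP->|/dl gd].
  exact: fsubsetUl.
exact: (fsubset_trans gd (fsubsetUr _ _)).
Qed.

(** A section [s] of the free cover gives coordinates of [M] (a dual basis), hence
    maps from [tensor M C] to [C], natural in [C], which together detect zero:
    [ker0]. *)
Lemma projective_flat (M : lmodType R) : projective M -> flat M.
Proof.
move=> Mp A B i ii.
have [p pb ps] := free_cover M.
have [s sE] := Mp _ _ p idfun ps.
have bl C t (c : C : lmodType R) : linear (fun m => fcoef t (s m) *: c).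
  by move=> r m m'; rewrite linearP fcoefD fcoefZ scalerDl scalerA.
have br (C : lmodType R) t m : linear (fun c : C => fcoef t (s m) *: c).
  by move=> r c c'; rewrite scalerDr !scalerA mulrC.
have kap (C : lmodType R) t := tensor_lin (fun c => bl C t c) (br C t).
have ker0 (C : lmodType R) (w : tensor M C) :
    (forall t, \sum_(x <- repr w) fcoef t (s x.1) *: x.2 = 0) -> w = 0.
  move=> w0; have [d dE] := msupp_bound (fun x : M * C => s x.1) (repr w).
  rewrite -(tensor_reprK w) tensor_class_sum big_seq.
  rewrite (eq_bigr (fun x => \sum_(t <- d) pure_tensor t (fcoef t (s x.1) *: x.2))).
    rewrite -big_seq exchange_big big1 //= => t _.
    have := linear_sum (mklin (@pure_tensor_linearr _ M C t)) (repr w) xpredT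
      (fun x => fcoef t (s x.1) *: x.2).
    by rewrite w0 linear0.
  move=> x /dE xd.
  have xE : x.1 = \sum_(t <- d) fcoef t (s x.1) *: t.
    rewrite -[LHS]sE {1}(free_sum xd) linear_sum; apply: eq_bigr => t _.
    by rewrite linearZ /= pb.
  rewrite {1}xE.
  have /= -> := linear_sum (mklin (@pure_tensor_linearl _ M C x.2)) d xpredT.
  by apply: eq_bigr => t _; apply/tensor_classP/TensorZ.
move=> u v uv; apply/subr0_eq/ker0 => t.
have [kA kAE kAs] := kap A t; have [kB kBE _] := kap B t.
rewrite -kAs; apply: ii; rewrite linear0.
have [ti tiE] : exists ti : {linear tensor M A -> tensor M B},
    forall w, ti w = tensor_map (idfun : {linear M -> M}) i w.
  by exists (mklin (tensor_map_linear idfun i)).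
have tE w : i (kA w) = kB (ti w).
  have := tensor_class_sum (repr w); rewrite tensor_reprK => ->.
  rewrite !linear_sum; apply: eq_bigr => x _.
  by rewrite kAE tiE tensor_map_pure kBE linearZ.
by rewrite tE [ti _]linearB !tiE uv subrr linear0.
Qed.

End TensorFlat.

(** * Dimensions over an almost perfect domain *)

Section Main.
Variable R : idomainType.
Hypothesis hR : almost_perfect_domain R.

(** The image of [d i] is the [i]-th syzygy of the flat resolution; as for
    injective dimension the induction runs downwards from [i = n]. *)
Lemma class_F_P1 n (M : lmodType R) : class_F n M -> class_P 1 M.
Proof.
move=> [P [d [e [Pf es ed dd P0]]]].
have Pf' i := flat_flat_in (Pf i).
have Zf i : flat_in (im_sub (d i)).
  have [k ik] : exists k, (n - i)%N = k by exists (n - i)%N.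
  elim: k i ik => [|k IH] i ik.
    apply: zero_flat => _ [x <-]; rewrite (_ : x = 0) ?linear0 //.
    by apply: P0; rewrite ltnS -subn_eq0 ik.
  apply: (image_flat hR (Pf' _)); last exact: flat_torsionfree (Pf' _).
  apply: flat_in_ext (IH i.+1 _) => [x|]; last by rewrite subnS ik.
  by apply: iff_sym; apply: dd.
have [p _ ps] := free_cover (P 0%N).
have Kf : flat_in (ker_sub (e \o p)).
  apply: (kernel_flat (Pf' 0%N) ps).
  by apply: flat_in_ext (Zf 0%N) => x; apply: iff_sym; apply: ed.
apply: (left_dim_le1 (i := subinj (ker_sub (e \o p))) (p := e \o p)
  _ (@free_projective R _) (flat_sub_free_projective hR Kf)).
- exact: zero_projective.
- exact: subinj_inj.
- by move=> y; have [x <-] := es y; have [z <-] := ps x; exists z.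
- move=> y; split=> [/= epy|[x <-]]; last exact: (subinjP x).
  by apply: subinj_surj.
Qed.

Lemma class_P_F n (M : lmodType R) : class_P n M -> class_F n M.
Proof.
move=> [P [d [e [Pp es ed dd P0]]]]; exists P, d, e; split=> // i.
exact: projective_flat.
Qed.

End Main.

Theorem proposition3p2 (R : idomainType) (hR : almost_perfect_domain R)
    (hQ : proper_fraction_field R) :
  same_class (@class_Ifin R) (@class_I R 1) /\
  (same_class (@class_Ffin R) (@class_F R 1) /\
   same_class (@class_F R 1) (@class_P R 1) /\
   same_class (@class_P R 1) (@class_Pfin R)).
Proof.
split; [|split; [|split]] => M; split.
- by case=> n; apply: class_I_le1.
- by exists 1%N.
- by case=> n /(class_F_P1 hR)/class_P_F.
- by exists 1%N.
- exact: class_F_P1.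
- exact: class_P_F.
- by exists 1%N.
- by case=> n /class_P_F/(class_F_P1 hR).
Qed.
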